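(* There is an algorithm for unencoding maximal semi-grid $C_{ab}$ codes: given a maximal semi-grid $C_{ab}$ code $\mathcal{C}_H(\mathcal{P},m)$ of length $n$ over a finite field $\mathbb{F}$ and a codeword $\mathbf{c}\in\mathcal{C}_H(\mathcal{P},m)$, it computes the unique $f\in\mathcal{L}(mP_\infty)$, in standard form, with $\operatorname{ev}_{\mathcal{P}}(f)=\mathbf{c}$, with complexity $$O\big(\nu_Y\,\mathsf{M}(n_X)\log n_X+n_X\,\mathsf{M}(\nu_Y)\log\nu_Y\big)\subset\tilde{O}(n)$$ operations in $\mathbb{F}$, where $n_X=n_X(\mathcal{P})$ and $\nu_Y=\nu_Y(\mathcal{P})$.
   Context: Let $a,b$ be coprime positive integers (not both $1$). Let $\operatorname{supp}(H)$ be the set of monomials with non-zero coefficient in $H$. $H\in\mathbb{F}[X,Y]$ is a $C_{ab}$ polynomial if: (i) $X^b,Y^a\in\operatorname{supp}(H)$; (ii) $X^iY^j\in\operatorname{supp}(H)$ implies $ai+bj\le ab$; (iii) $\langle H,\partial H/\partial X,\partial H/\partial Y\rangle=\mathbb{F}[X,Y]$. Such $H$ is absolutely irreducible; its function field $\mathbb{F}(x,y)$, $H(x,y)=0$, has genus $g=(a-1)(b-1)/2$ and a unique rational place $P_\infty$ that is the only pole of $x$ and of $y$; $x^iy^j$ has pole order $ai+bj$ there. The other rational places (finite rational places) are identified with the points $(\alpha,\beta)\in\mathbb{F}^2$ with $H(\alpha,\beta)=0$. Each $f\in\mathbb{F}[x,y]=\mathbb{F}[X,Y]/\langle H\rangle$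 has a unique representation with $y$-degree at most $a-1$, its standard form. The Riemann–Roch space $\mathcal{L}(mP_\infty)$ is the $\mathbb{F}$-span of $B=\{x^iy^j\mid ai+bj\le m,\ 0\le j\le a-1\}$. For a set $\mathcal{P}=\{P_1,\dots,P_n\}$ of distinct finite rational places and an integer $m\ge0$, $\mathcal{C}_H(\mathcal{P},m)=\{\operatorname{ev}_{\mathcal{P}}(f)\mid f\in\mathcal{L}(mP_\infty)\}$ with $\operatorname{ev}_{\mathcal{P}}(f)=(f(P_1),\dots,f(P_n))$. $n_X(\mathcal{P})$ is the number of distinct $X$-coordinates of points of $\mathcal{P}$; for $\alpha\in\mathbb{F}$, $\mathcal{Y}_\alpha(\mathcal{P})=\{\beta\mid(\alpha,\beta)\in\mathcal{P}\}$ and $\nu_Y(\mathcal{P})=\max_\alpha|\mathcal{Y}_\alpha(\mathcal{P})|$. $\mathcal{P}$ is a semi-grid if $|\mathcal{Y}_\alpha(\mathcal{P})|\in\{0,\nu_Y(\mathcal{P})\}$ for every $\alpha\in\mathbb{F}$. The code $\mathcal{C}_H(\mathcal{P},m)$ is maximal semi-grid if $\mathcal{P}$ is a semi-grid with $\nu_Y(\mathcal{P})=a=\deg_Y(H)$ and $m<n$; then $\operatorname{ev}_{\mathcal{P}}$ is injective on $\mathcal{L}(mP_\infty)$. Messages are the coefficient vectors of $f$ on the basis $B$; unencoding is the recovery of this message from the codeword $\operatorname{ev}_{\mathcal{P}}(f)$. Complexity is the number of arithmetic operations in $\mathbb{F}$ in an algebraic RAM model (table lookup and insertion cost $O(1)$);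 implied constants are absolute. $\mathsf{M}(n)$ is the cost of multiplying two univariate polynomials over $\mathbb{F}$ of degree at most $n$, taken in $O(n\log n\log\log n)\subset\tilde{O}(n)$, with $\mathsf{M}(n)/n$ nondecreasing and $\mathsf{M}(cn)\in O(\mathsf{M}(n))$ for each constant $c$. $\tilde{O}(h)=\bigcup_{c\ge0}O(h\log^c h)$, and $\log t$ is read as $\max(1,\log t)$. *)

(* Defs.v *)
From HB Require Import structures.
From mathcomp Require Import all_boot all_order all_algebra.
From mathcomp Require Import reals exp.

Set Implicit Arguments.
Unset Strict Implicit.
Unset Printing Implicit Defensive.

Import Order.TTheory GRing.Theory Num.Theory.

Local Open Scope ring_scope.

(** * An algebraic RAM

  Programs are syntactic objects that do not mention a field: one program is
  run over all fields.  The store consists of natural numbers (indices and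
  loop counters), of field elements, and of tables whose keys are field
  elements.  Field elements can only be combined by the field operations,
  tested for equality, and used as table keys.

  Each arithmetic operation, each memory access, each table lookup or
  insertion, each test and each command costs 1; so the cost of a run bounds
  in particular the number of arithmetic operations in the field. *)

Inductive iexp : Type :=
| ICst of nat
| ILd of iexp                (* integer cell at a computed address *)
| IAdd of iexp & iexp
| ISub of iexp & iexp        (* truncated *)
| IMul of iexp & iexp
| IDiv of iexp & iexp.       (* Euclidean quotient *)

Inductive fexp : Type :=
| FZero
| FOne
| FLd of iexp                (* field cell at a computed address *)
| FAdd of fexp & fexp
| FSub of fexp & fexp
| FMul of fexp & fexp
| FDiv of fexp & fexp.

Inductive bexp : Type :=
| BLe of iexp & iexp
| BEq of fexp & fexp
| BNot of bexp
| BAnd of bexp & bexp.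

(* [Call q ai li af lf d ld] runs [q] in a fresh store that holds a copy of
   the [li] integer cells from address [ai] on and of the [lf] field cells
   from [af] on, both placed at address 0, and then copies the first [ld]
   field cells of [q]'s final store back to address [d]. *)
Inductive cmd : Type :=
| Skip
| SetI of iexp & iexp             (* address, value *)
| SetF of iexp & fexp             (* address, value *)
| Insert of iexp & fexp & iexp    (* table, key, value *)
| Lookup of iexp & iexp & fexp    (* destination address, table, key *)
| Seq of cmd & cmd
| If of bexp & cmd & cmd
| While of bexp & cmd
| Call of cmd & iexp & iexp & iexp & iexp & iexp & iexp.

(* An absent key is looked up as 0. *)
Record store (F : fieldType) : Type := Store {
  imem : nat -> nat;
  fmem : nat -> F;
  tabs : nat -> F -> nat }.

Section Semantics.
Variable F : fieldType.
Implicit Types s : store F.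

Fixpoint ieval s (e : iexp) : nat :=
  match e with
  | ICst n => n
  | ILd e1 => imem s (ieval s e1)
  | IAdd e1 e2 => (ieval s e1 + ieval s e2)%N
  | ISub e1 e2 => (ieval s e1 - ieval s e2)%N
  | IMul e1 e2 => (ieval s e1 * ieval s e2)%N
  | IDiv e1 e2 => (ieval s e1 %/ ieval s e2)%N
  end.

Fixpoint feval s (e : fexp) : F :=
  match e with
  | FZero => 0
  | FOne => 1
  | FLd e1 => fmem s (ieval s e1)
  | FAdd e1 e2 => feval s e1 + feval s e2
  | FSub e1 e2 => feval s e1 - feval s e2
  | FMul e1 e2 => feval s e1 * feval s e2
  | FDiv e1 e2 => feval s e1 / feval s e2
  end.

Fixpoint beval s (e : bexp) : bool :=
  match e with
  | BLe e1 e2 => (ieval s e1 <= ieval s e2)%N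
  | BEq e1 e2 => feval s e1 == feval s e2
  | BNot e1 => ~~ beval s e1
  | BAnd e1 e2 => beval s e1 && beval s e2
  end.

Fixpoint icost (e : iexp) : nat :=
  match e with
  | ICst _ => 1%N
  | ILd e1 => (icost e1).+1
  | IAdd e1 e2 | ISub e1 e2 | IMul e1 e2 | IDiv e1 e2 =>
      (icost e1 + icost e2).+1
  end.

Fixpoint fcost (e : fexp) : nat :=
  match e with
  | FZero | FOne => 1%N
  | FLd e1 => (icost e1).+1
  | FAdd e1 e2 | FSub e1 e2 | FMul e1 e2 | FDiv e1 e2 =>
      (fcost e1 + fcost e2).+1
  end.

Fixpoint bcost (e : bexp) : nat :=
  match e with
  | BLe e1 e2 => (icost e1 + icost e2).+1
  | BEq e1 e2 => (fcost e1 + fcost e2).+1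
  | BNot e1 => (bcost e1).+1
  | BAnd e1 e2 => (bcost e1 + bcost e2).+1
  end.

Definition set_imem s (x v : nat) : store F :=
  Store (fun y => if y == x then v else imem s y) (fmem s) (tabs s).

Definition set_fmem s (x : nat) (v : F) : store F :=
  Store (imem s) (fun y => if y == x then v else fmem s y) (tabs s).

Definition set_tabs s (d : nat) (z : F) (v : nat) : store F :=
  Store (imem s) (fmem s)
    (fun d' z' => if (d' == d) && (z' == z) then v else tabs s d' z').

Definition set_block s (d l : nat) (g : nat -> F) : store F :=
  Store (imem s)
    (fun y => if (d <= y < d + l)%N then g (y - d)%N else fmem s y) (tabs s).

Definition block (T : Type) (g : nat -> T) (x l : nat) : seq T :=
  mkseq (fun i => g (x + i)%N) l.

Definition start (u : seq nat) (v : seq F) : store F :=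
  Store (nth 0%N u) (nth 0 v) (fun _ _ => 0%N).

(* [exec c s k s']: from [s], the program [c] halts in [s'] at cost [k]. *)
Inductive exec : cmd -> store F -> nat -> store F -> Prop :=
| exec_skip s : exec Skip s 1 s
| exec_seti s e1 e2 :
    exec (SetI e1 e2) s (icost e1 + icost e2).+1
      (set_imem s (ieval s e1) (ieval s e2))
| exec_setf s e1 e2 :
    exec (SetF e1 e2) s (icost e1 + fcost e2).+1
      (set_fmem s (ieval s e1) (feval s e2))
| exec_insert s d z e :
    exec (Insert d z e) s (icost d + fcost z + icost e).+1
      (set_tabs s (ieval s d) (feval s z) (ieval s e))
| exec_lookup s e d z :
    exec (Lookup e d z) s (icost e + icost d + fcost z).+1
      (set_imem s (ieval s e) (tabs s (ieval s d) (feval s z)))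
| exec_seq c1 c2 s k1 s1 k2 s2 :
    exec c1 s k1 s1 -> exec c2 s1 k2 s2 ->
    exec (Seq c1 c2) s (k1 + k2).+1 s2
| exec_if b c1 c2 s k s' :
    exec (if beval s b then c1 else c2) s k s' ->
    exec (If b c1 c2) s (bcost b + k).+1 s'
| exec_while_false b c s :
    ~~ beval s b -> exec (While b c) s (bcost b).+1 s
| exec_while_true b c s k1 s1 k2 s2 :
    beval s b -> exec c s k1 s1 -> exec (While b c) s1 k2 s2 ->
    exec (While b c) s (bcost b + k1 + k2).+1 s2
| exec_call q ai li af lf d ld s k s' :
    exec q (start (block (imem s) (ieval s ai) (ieval s li))
                  (block (fmem s) (ieval s af) (ieval s lf))) k s' ->
    exec (Call q ai li af lf d ld) s
      (icost ai + icost li + icost af + icost lf + icost d + icost ld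
       + ieval s li + ieval s lf + ieval s ld + k).+1
      (set_block s (ieval s d) (ieval s ld) (fmem s')).

(* On the integers [u] and the field elements [v], the program halts at cost
   [k], with the sequence [w] at the beginning of its field memory. *)
Definition computes (c : cmd) (u : seq nat) (v : seq F) (k : nat)
    (w : seq F) : Prop :=
  exists2 s', exec c (start u v) k s' & block (fmem s') 0 (size w) = w.

End Semantics.

(** * Cost functions *)

Definition lg (R : realType) (t : R) : R := Num.max 1 (ln t).

(* [mul] multiplies polynomials of degree at most [n], given by their [n + 1]
   coefficients in increasing order of degree, over every finite field. *)
Definition multiplies (R : realType) (mul : cmd) (M : nat -> R) : Prop :=
  forall (F : finFieldType) (n : nat) (p q : {poly F}), (0 < n)%N ->
    (size p <= n.+1)%N -> (size q <= n.+1)%N ->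
  exists2 k : nat, k%:R <= M n &
    computes mul [:: n] (mkseq (fun i => p`_i) n.+1 ++ mkseq (fun i => q`_i) n.+1)
      k (mkseq (fun i => (p * q)`_i) (2 * n).+1%N).

Definition multiplication_time (R : realType) (M : nat -> R) : Prop :=
  [/\ exists K : R, forall n : nat, (0 < n)%N ->
        M n <= K * (n%:R * lg n%:R * lg (lg n%:R)),
      forall m n : nat, (0 < m)%N -> (m <= n)%N -> M m / m%:R <= M n / n%:R
    & forall c : nat, (0 < c)%N ->
        exists K : R, forall n : nat, (0 < n)%N -> M (c * n)%N <= K * M n].

(** * C_ab curves and codes

  An element [H] of [{poly {poly F}}] is read as a polynomial in X (the outer
  variable) with coefficients in F[Y]: [H`_i`_j] is the coefficient of
  X^i Y^j, and [H.[x, y]] is the value of [H] at X = x, Y = y. *)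

Section Cab.
Variable F : finFieldType.
Implicit Types (H f g : {poly {poly F}}) (a b m : nat).
Implicit Types (P : seq (F * F)) (al : F).

Definition supp H (i j : nat) : bool := H`_i`_j != 0.

Definition Cab_poly a b H : Prop :=
  [/\ [/\ (0 < a)%N, (0 < b)%N, coprime a b & ~~ ((a == 1%N) && (b == 1%N))],
      supp H b 0 /\ supp H 0 a,
      forall i j, supp H i j -> (a * i + b * j <= a * b)%N
    & forall G : {poly {poly F}}, exists u v w : {poly {poly F}},
        G = u * H + v * H^`() + w * map_poly (fun p : {poly F} => p^`()) H].

(* Elements of F[x, y] = F[X, Y] / <H> are represented by polynomials, up to
   the following congruence. *)
Definition eq_mod H f g : Prop := exists q : {poly {poly F}}, f - g = q * H.

Definition standard_form a f : Prop := forall i j, supp f i j -> (j < a)%N.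

(* The exponents (i, j) of the monomials of the basis of L(m P_oo); the bound
   i <= m / a is implied by a i + b j <= m. *)
Definition basisB a b m : seq (nat * nat) :=
  [seq ij <- [seq (i, j) | i <- iota 0 (m %/ a).+1, j <- iota 0 a]
     | (a * ij.1 + b * ij.2 <= m)%N].

(* [f] represents an element of L(m P_oo), the span of the monomials of B. *)
Definition RR_space a b H m f : Prop :=
  exists2 g : {poly {poly F}},
    (forall i j, supp g i j -> (i, j) \in basisB a b m) & eq_mod H f g.

(* The places P_1, ..., P_n, in the order that indexes the codewords. *)
Definition finite_places H P : Prop :=
  uniq P /\ (forall p, p \in P -> H.[p.1, p.2] = 0).

Definition ev P f : seq F := [seq f.[p.1, p.2] | p <- P].

Definition in_code a b H P m (c : seq F) : Prop :=
  exists2 f, RR_space a b H m f & c = ev P f.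

Definition nX P : nat := #|[set p.1 | p in P]|.

Definition Yset P al : {set F} := [set be | (al, be) \in P].

Definition nuY P : nat := \max_(al : F) #|Yset P al|.

Definition semi_grid P : Prop :=
  forall al : F, #|Yset P al| = 0%N \/ #|Yset P al| = nuY P.

Definition maximal_semi_grid_code a b H P m : Prop :=
  [/\ Cab_poly a b H, finite_places H P, semi_grid P, nuY P = a
    & (m < size P)%N].

(* The field elements that describe the code and the codeword: the points,
   the codeword, and the coefficients of H. *)
Definition input_data a b H P (c : seq F) : seq F :=
  flatten [seq [:: p.1; p.2] | p <- P] ++ c ++
  [seq H`_i`_j | i <- iota 0 b.+1, j <- iota 0 a.+1].

Definition message a b m f : seq F :=
  [seq f`_ij.1`_ij.2 | ij <- basisB a b m].

End Cab.

Definition unencoding_bound (R : realType) (M : nat -> R) (n_X nu_Y : nat) : R :=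
  nu_Y%:R * M n_X * lg n_X%:R + n_X%:R * M nu_Y * lg nu_Y%:R.

(* Main.v *)
Require Import Defs.
From HB Require Import structures.
From mathcomp Require Import all_boot all_order all_algebra.
From mathcomp Require Import reals exp.
From mathcomp Require Import zify ring lra.

Set Implicit Arguments.
Unset Strict Implicit.
Unset Printing Implicit Defensive.

Import Order.TTheory GRing.Theory Num.Theory.

(** A function in the span of B has, in standard form, X-degree at most m / a
    and Y-degree below a, and m < n = n_X a gives m / a < n_X.  On a maximal
    semi-grid every column (the points with a given X-coordinate) has exactly
    a points, so such a function is determined by its values, column by
    column.  The program recovers it in two rounds of univariate
    interpolation: for each X-coordinate al, the polynomial f(al, Y) from the
    a values in that column; then, for each j < a, the coefficient of Y^j, a
    polynomial in X of degree below n_X, from its n_X values.  Both rounds use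
    [Interp], whose correctness is [run_Interp]; the whole program is
    [run_Unencode].  The message only depends on the class of the function
    modulo H through its standard form, which is unique because H, as a
    polynomial in Y, has degree a ([standard_unique]).

    Interpolation at n points in O(M(n) log n) goes through the tree of
    subproducts of the points.  Write f = sum_i w_i prod_(j <> i) (X - x_j),
    where w_i = f(x_i) / V'(x_i) and V = prod_j (X - x_j).  Going up the tree
    the sum is assembled from the w_i by S = S_left R_right + S_right R_left.
    The values V'(x_i) come from the transposed algorithm, which avoids
    division with remainder: for N >= n and r = X^(N-1) V'(1/X), the value
    V'(x) is the coefficient of degree N - 1 in the series r / (1 - x X); one
    starts from the series r / R, for R the product of all 1 - x_i X, and goes
    down the tree, multiplying at each node by the sibling subproduct.  Only a
    window of as many coefficients as there are leaves below the node has to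
    be kept ([coef_window]), so a level costs O(M(N)).  All polynomials are
    reversed, with factors 1 - x X in place of X - x: padding the points with
    zeros up to a power of two N then changes nothing.

    Each program is proved correct together with a cost bound in a small
    Hoare logic.  Subroutines are run by [Call], in a fresh store, so that
    their specifications only mention their own inputs and outputs.  Operation
    counts are natural numbers in terms of the integer part mu of M, for which
    k mu(n) <= mu(k n); the last part translates them into real bounds. *)

Local Open Scope nat_scope.

(** * Running programs within a cost bound *)

Declare Scope prog_scope.
Delimit Scope prog_scope with P.
#[local] Arguments IAdd _%_P _%_P.
#[local] Arguments ISub _%_P _%_P.
#[local] Arguments IMul _%_P _%_P.
#[local] Arguments IDiv _%_P _%_P.
#[local] Arguments BLe _%_P _%_P.
#[local] Arguments BEq _%_P _%_P.
#[local] Arguments BAnd _%_P _%_P.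
#[local] Arguments BNot _%_P.
#[local] Arguments SetI _%_P _%_P.
#[local] Arguments SetF _%_P _%_P.
#[local] Arguments Insert _%_P _%_P _%_P.
#[local] Arguments Lookup _%_P _%_P _%_P.
#[local] Arguments If _%_P _%_P _%_P.
#[local] Arguments While _%_P _%_P.
#[local] Arguments Seq _%_P _%_P.
#[local] Arguments FAdd _%_P _%_P.
#[local] Arguments FSub _%_P _%_P.
#[local] Arguments FMul _%_P _%_P.
#[local] Arguments FDiv _%_P _%_P.
#[local] Arguments Call _ _%_P _%_P _%_P _%_P _%_P _%_P.
#[local] Arguments FLd _%_P.
#[local] Arguments ILd _%_P.
Local Coercion ICst : nat >-> iexp.
Local Notation "x + y" := (IAdd x y) : prog_scope.
Local Notation "x - y" := (ISub x y) : prog_scope.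
Local Notation "x * y" := (IMul x y) : prog_scope.
Local Notation "x / y" := (IDiv x y) : prog_scope.
Local Notation "x <= y" := (BLe x y) : prog_scope.
Local Notation "x < y" := (BNot (BLe y x)) : prog_scope.
Local Notation "$ x" := (ILd (ICst x)) (at level 1, x at level 0, format "$ x") : prog_scope.
Local Notation "c1 ;; c2" := (Seq c1 c2) (at level 90, right associativity) : prog_scope.

(** The bound [e] is evaluated anew before each turn. *)
Definition For (i : nat) (e : iexp) (body : cmd) : cmd :=
  Seq (SetI i 0) (While ($i < e) (Seq body (SetI i ($i + 1)))).
#[local] Arguments For _ _%_P _%_P.

(** A call of the empty program moves a block of field cells: the fresh store
    holds the source, and is zero beyond it, so the destination may be longer
    than the source and is then padded with zeros. *)
Definition Copy (src ls dst ld : iexp) : cmd := Call Skip 0 0 src ls dst ld.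
#[local] Arguments Copy _%_P _%_P _%_P _%_P.

Section Logic.
Variable F : fieldType.
Implicit Types (s : store F) (Q : store F -> Prop).

(** Total correctness.  The cost is only bounded by [K], so that bounds can be
    rounded up at any point of a derivation. *)
Definition run (c : cmd) s (K : nat) Q : Prop :=
  exists k s', [/\ exec c s k s', k <= K & Q s'].

(** The specification of a subroutine: [Call] passes nothing back but field
    memory, so only the final field memory is described. *)
Definition yields (q : cmd) (u : seq nat) (v : seq F) (K : nat) (P : (nat -> F) -> Prop) :=
  run q (start u v) K (fun s => P (fmem s)).

Definition upto (l : nat) (w m : nat -> F) := forall i, i < l -> m i = w i.

Lemma run_le K' c s K Q : run c s K' Q -> K' <= K -> run c s K Q.
Proof. by case=> k [s' [h1 h2 h3]] le; exists k, s'; split=> //; apply: leq_trans le. Qed.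

Lemma run_post Q' c s K Q : run c s K Q' -> (forall s', Q' s' -> Q s') -> run c s K Q.
Proof. by case=> k [s' [h1 h2 h3]] le; exists k, s'; split=> //; apply: le. Qed.

Lemma run_skip s Q : Q s -> run Skip s 1 Q.
Proof. by exists 1, s; split=> //; constructor. Qed.

Lemma run_seti e1 e2 s x v Q : ieval s e1 = x -> ieval s e2 = v ->
  Q (set_imem s x v) -> run (SetI e1 e2) s (icost e1 + icost e2).+1 Q.
Proof. by move=> <- <- ?; do 2!eexists; split; [constructor| |]. Qed.

Lemma run_setf e1 e2 s x v Q : ieval s e1 = x -> feval s e2 = v ->
  Q (set_fmem s x v) -> run (SetF e1 e2) s (icost e1 + fcost e2).+1 Q.
Proof. by move=> <- <- ?; do 2!eexists; split; [constructor| |]. Qed.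

Lemma run_insert d z e s x y v Q : ieval s d = x -> feval s z = y -> ieval s e = v ->
  Q (set_tabs s x y v) -> run (Insert d z e) s (icost d + fcost z + icost e).+1 Q.
Proof. by move=> <- <- <- ?; do 2!eexists; split; [constructor| |]. Qed.

Lemma run_lookup e d z s x v Q : ieval s e = x ->
  tabs s (ieval s d) (feval s z) = v ->
  Q (set_imem s x v) -> run (Lookup e d z) s (icost e + icost d + fcost z).+1 Q.
Proof. by move=> <- <- ?; do 2!eexists; split; [constructor| |]. Qed.

Lemma run_seq c1 c2 s K1 K2 Q : run c1 s K1 (fun s1 => run c2 s1 K2 Q) ->
  run (Seq c1 c2) s (K1 + K2).+1 Q.
Proof.
case=> k1 [s1 [h1 l1 [k2 [s2 [h2 l2 q]]]]]; exists (k1 + k2).+1, s2.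
by split=> //; [apply: exec_seq h1 h2 | rewrite ltnS leq_add].
Qed.

(** Adding the costs of both branches, instead of taking their maximum, lets
    the two bounds be inferred independently of each other. *)
Lemma run_if b c1 c2 s K1 K2 Q :
  (beval s b -> run c1 s K1 Q) -> (~~ beval s b -> run c2 s K2 Q) ->
  run (If b c1 c2) s (bcost b + K1 + K2).+1 Q.
Proof.
case: (boolP (beval s b)) => hb; [move=> /(_ isT) h _ | move=> _ /(_ isT) h].
  case: h => k [s' [h1 l q]]; exists (bcost b + k).+1, s'; split=> //; last by lia.
  by constructor; rewrite hb.
case: h => k [s' [h1 l q]]; exists (bcost b + k).+1, s'; split=> //; last by lia.
by constructor; rewrite (negPf hb).
Qed.

(** The invariant carries the value of the counter and of the bound, hence
    the body may read the counter and must restore it. *)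
Lemma run_for (Inv : nat -> store F -> Prop) n K i e body s Q :
  (forall t s1, t <= n -> Inv t s1 -> imem s1 i = t /\ ieval s1 e = n) ->
  Inv 0 (set_imem s i 0) ->
  (forall t s1, t < n -> Inv t s1 ->
     run body s1 K (fun s2 => Inv t.+1 (set_imem s2 i (imem s2 i).+1))) ->
  (forall s1, Inv n s1 -> Q s1) ->
  run (For i e body) s (n * (K + icost e + 12) + icost e + 9) Q.
Proof.
move=> hI h0 hS hQ.
have hW : forall d t s1, t + d = n -> Inv t s1 ->
    run (While ($i < e)%P (Seq body (SetI i ($i + 1)))) s1
      (d * (K + icost e + 12) + icost e + 5) Q.
  elim=> [|d IH] t s1 td ht.
    have [e1 e2] := hI t s1 ltac:(lia) ht.
    exists (bcost ($i < e)%P).+1, s1; split; last by apply: hQ; rewrite -td addn0.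
      by apply: exec_while_false; rewrite /= e1 e2; lia.
    by rewrite /=; lia.
  have [e1 e2] := hI t s1 ltac:(lia) ht.
  have [k [s2 [x2 l2 q2]]] := hS t s1 ltac:(lia) ht.
  have [k' [s3 [x3 l3 q3]]] := IH t.+1 _ ltac:(lia) q2.
  have E : set_imem s2 i (imem s2 i).+1
      = set_imem s2 (ieval s2 i) (ieval s2 ($i + 1)%P) by rewrite /= addn1.
  rewrite E in x3.
  eexists; exists s3; split; last by [].
    apply: (exec_while_true _ _ x3); first by rewrite /= e1 e2; lia.
    apply: exec_seq x2 _.
    exact: exec_seti.
  by rewrite /=; lia.
have [k [s2 [x2 l2 q2]]] := hW n 0 _ (add0n n) h0.
exists (3 + k).+1, s2; split=> //; last by lia.
apply: exec_seq x2; exact: (@exec_seti _ s i 0).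
Qed.

(** The final store is only known through the specification [P], so that
    stores do not grow along a symbolic run. *)
Lemma run_call u v K P nli nlf nd nld q ai li af lf d ld s Q :
  ieval s li = nli -> ieval s lf = nlf -> ieval s d = nd -> ieval s ld = nld ->
  block (imem s) (ieval s ai) nli = u ->
  block (fmem s) (ieval s af) nlf = v ->
  yields q u v K P ->
  (forall s' w, P w -> imem s' = imem s -> tabs s' = tabs s ->
     (forall y, fmem s' y = if nd <= y < nd + nld then w (y - nd) else fmem s y) ->
     Q s') ->
  run (Call q ai li af lf d ld) s
   (icost ai + icost li + icost af + icost lf + icost d + icost ld
       + nli + nlf + nld + K).+1 Q.
Proof.
move=> <- <- <- <- <- <- [k [s' [x l h]]] hQ.
do 2!eexists; split; first by constructor; exact: x.
  by rewrite ltnS leq_add2l.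
exact: hQ h _ _ _.
Qed.

Lemma nth_block T (x0 : T) (g : nat -> T) a l i :
  nth x0 (block g a l) i = if i < l then g (a + i) else x0.
Proof.
case: ltnP => h; first by rewrite nth_mkseq.
by rewrite nth_default // size_mkseq.
Qed.

Lemma run_copy nsrc nls nd nld src ls dst ld s Q :
  ieval s src = nsrc -> ieval s ls = nls -> ieval s dst = nd -> ieval s ld = nld ->
  (forall s', imem s' = imem s -> tabs s' = tabs s ->
     (forall y, fmem s' y = if nd <= y < nd + nld then
          if y - nd < nls then fmem s (nsrc + (y - nd)) else 0%R else fmem s y) ->
     Q s') ->
  run (Copy src ls dst ld) s
   (icost src + icost ls + icost dst + icost ld + nls + nld + 4) Q.
Proof.
move=> e1 e2 e3 e4 hQ.
apply: run_le.
  apply: (run_call (u := [::]) (v := block (fmem s) nsrc nls)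
            (P := eq (fmem (start [::] (block (fmem s) nsrc nls))))
            erefl e2 e3 e4); rewrite ?e1 //.
    exact: run_skip.
  move=> s' w <- i t m; apply: hQ => // y; rewrite m; case: ifP => // _.
  by rewrite /= nth_block.
by rewrite /=; lia.
Qed.

End Logic.

(** * Product trees, Lagrange interpolation, Newton inversion *)

Section Trees.
Local Open Scope ring_scope.
Variables (F : fieldType) (x w : nat -> F).

(** The reversal of X - a.  It is 1 for a = 0, which makes zero padding of
    the points harmless. *)
Definition lin (a : F) : {poly F} := 1 - a *: 'X.

Lemma size_lin a : (size (lin a) <= 2)%N.
Proof.
rewrite /lin (leq_trans (size_polyD _ _)) // geq_max size_polyC size_polyN.
by rewrite (leq_trans (size_scale_leq _ _)) ?size_polyX // (leq_trans (leq_b1 _)).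
Qed.

Lemma coef_linM a (p : {poly F}) k :
  (lin a * p)`_k = p`_k - a * (if k is k'.+1 then p`_k' else 0).
Proof.
rewrite mulrBl mul1r coefB -scalerAl coefZ coefXM; by case: k.
Qed.

(** The subproduct at node [v] of height [l], whose children are the nodes
    [v.*2] and [v.*2.+1] of height [l - 1]. *)
Fixpoint ptree l v : {poly F} :=
  if l is l'.+1 then ptree l' v.*2 * ptree l' v.*2.+1 else lin (x v).

(** The numerator of the sum of the fractions w_i / (1 - x_i X) over the
    leaves below the node, with denominator [ptree]. *)
Fixpoint stree l v : {poly F} :=
  if l is l'.+1 then stree l' v.*2 * ptree l' v.*2.+1
                   + stree l' v.*2.+1 * ptree l' v.*2
  else (w v)%:P.

Definition sibling v := if odd v then v.-1 else v.+1.

(** Here [t] is a depth, [L] the height of the tree.  The value is [U] times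
    all the leaf factors outside the node; equivalently, [U] times the root
    divided by the node. *)
Fixpoint utree (U : {poly F}) L t v : {poly F} :=
  if t is t'.+1 then utree U L t' v./2 * ptree (L - t) (sibling v) else U.

Lemma size_ptree l v : (size (ptree l v) <= (2 ^ l).+1)%N.
Proof.
elim: l v => [|l IH] v /=; first exact: size_lin.
apply: leq_trans (size_polyMleq _ _) _.
by have := IH v.*2; have := IH v.*2.+1; rewrite expnS; lia.
Qed.

Lemma size_stree l v : (size (stree l v) <= 2 ^ l)%N.
Proof.
elim: l v => [|l IH] v /=; first by rewrite size_polyC leq_b1.
apply: leq_trans (size_polyD _ _) _; rewrite geq_max.
have h (a b : nat) : (size (stree l a * ptree l b)%R <= 2 ^ l.+1)%N.
  apply: leq_trans (size_polyMleq _ _) _.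
  by have := IH a; have := size_ptree l b; rewrite expnS; lia.
by rewrite !h.
Qed.

(** The two halves of a parent complete each other: what is missing at a
    child is what is missing at the parent and the sibling. *)
Lemma ptree_mul_utree U L t v : (t <= L)%N -> (v < 2 ^ t)%N ->
  ptree (L - t) v * utree U L t v = ptree L 0 * U.
Proof.
elim: t v => [|t IH] v tL; first by case: v; rewrite ?subn0.
rewrite expnS => hv /=.
have hv2 : (v./2 < 2 ^ t)%N by lia.
rewrite -(IH _ _ hv2); last by lia.
have -> : (L - t = (L - t.+1).+1)%N by lia.
rewrite /= mulrCA mulrC; congr (_ * _).
rewrite /sibling; case: ifP => ov.
  have -> : (v./2.*2 = v.-1)%N by lia.
  by case: (v) ov => // v' _; rewrite mulrC.
have -> : (v./2.*2 = v)%N by lia.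
by rewrite mulrC.
Qed.

Lemma ptreeE l v :
  ptree l v = \prod_(v * 2 ^ l <= i < v.+1 * 2 ^ l) lin (x i).
Proof.
elim: l v => [|l IH] v /=; first by rewrite expn0 !muln1 big_nat1.
rewrite !IH.
have -> : (v * 2 ^ l.+1 = v.*2 * 2 ^ l)%N by rewrite expnS; lia.
have -> : (v.+1 * 2 ^ l.+1 = v.*2.+2 * 2 ^ l)%N by rewrite expnS; lia.
by rewrite [RHS](big_cat_nat (n := (v.*2.+1 * 2 ^ l)%N)) //= leq_mul2r ?leqnSn ?orbT.
Qed.

Lemma streeE l v :
  stree l v = \sum_(v * 2 ^ l <= i < v.+1 * 2 ^ l)
    w i *: \prod_(v * 2 ^ l <= j < v.+1 * 2 ^ l | j != i) lin (x j).
Proof.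
elim: l v => [|l IH] v /=.
  by rewrite expn0 !muln1 big_nat1 big_mkcond big_nat1 eqxx /= alg_polyC.
rewrite !IH !ptreeE.
have -> : (v * 2 ^ l.+1 = v.*2 * 2 ^ l)%N by rewrite expnS; lia.
have -> : (v.+1 * 2 ^ l.+1 = v.*2.+2 * 2 ^ l)%N by rewrite expnS; lia.
have : (v.*2 * 2 ^ l <= v.*2.+1 * 2 ^ l)%N by rewrite leq_mul2r leqnSn orbT.
have : (v.*2.+1 * 2 ^ l <= v.*2.+2 * 2 ^ l)%N.
  by rewrite leq_mul2r leqnSn orbT.
move: (v.*2 * 2 ^ l)%N (v.*2.+1 * 2 ^ l)%N (v.*2.+2 * 2 ^ l)%N.
move=> A B C BC AB.
rewrite [RHS](big_cat_nat (n := B)) //= !mulr_suml; congr (_ + _).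
  apply: eq_big_nat => i /andP[hi1 hi2].
  rewrite -scalerAl; congr (_ *: _).
  rewrite [RHS](big_cat_nat (n := B)) //=; congr (_ * _).
  rewrite [RHS]big_nat_cond [LHS]big_nat_cond; apply: eq_bigl => j /=; lia.
apply: eq_big_nat => i /andP[hi1 hi2].
rewrite -scalerAl; congr (_ *: _).
rewrite [RHS](big_cat_nat (n := B)) //= mulrC; congr (_ * _).
rewrite [RHS]big_nat_cond [LHS]big_nat_cond; apply: eq_bigl => j /=; lia.
Qed.

(** Dividing by 1 - a X is Horner's rule: the coefficients u_k of the
    quotient satisfy u_k = p_k + a u_(k-1), so that the last one is the value
    at a of the reversed polynomial. *)
Lemma leaf_eval a (U p f : {poly F}) N : (0 < N)%N -> (size f <= N)%N ->
  (forall k, (k < N)%N -> (lin a * U)`_k = p`_k) ->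
  (forall i, (i < N)%N -> p`_(N.-1 - i) = f`_i) -> U`_N.-1 = f.[a].
Proof.
move=> N0 sf hU hp.
have hk k : (k < N)%N -> U`_k = \sum_(j < k.+1) p`_(k - j) * a ^+ j.
  elim: k => [|k IH] hk.
    have := hU 0%N hk; rewrite coef_linM mulr0 subr0 => ->.
    by rewrite big_ord1 expr0 mulr1.
  have := hU _ hk; rewrite coef_linM => /eqP; rewrite subr_eq => /eqP ->.
  rewrite (IH (ltnW hk)) [RHS]big_ord_recl /= expr0 mulr1; congr (_ + _).
  rewrite mulr_sumr; apply: eq_bigr => i _.
  by rewrite subSS mulrCA -exprS.
rewrite hk ?(horner_coef_wide _ sf) prednK //.
by apply: eq_bigr => i _; rewrite hp.
Qed.

(** Reversal exchanges the factors 1 - x X and X - x. *)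
Lemma coef_rev_prod (r : seq nat) k : (k <= size r)%N ->
  (\prod_(i <- r) lin (x i))`_k = (\prod_(i <- r) ('X - (x i)%:P))`_(size r - k).
Proof.
elim: r k => [|i r IH] k /=.
  by rewrite leqn0 => /eqP ->; rewrite !big_nil subn0.
rewrite !big_cons coef_linM mulrBl coefB coefXM coefCM => hk.
have sz : (\prod_(i <- r) ('X - (x i)%:P))`_(size r).+1 = 0.
  by rewrite nth_default // size_prod_XsubC.
have sz' : (\prod_(i <- r) lin (x i))`_(size r).+1 = 0.
  rewrite nth_default //; elim: (r) => [|j r' IHr]; first by rewrite big_nil size_poly1.
  rewrite big_cons; apply: leq_trans (size_polyMleq _ _) _.
  by have := size_lin (x j); move: IHr => /=; lia.
case: k hk => [|k] hk.
  by rewrite subn0 /= sz !mulr0 !subr0 IH // subn0.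
rewrite subSS /=.
have [ek|nk] := eqVneq k (size r).
  by rewrite ek (IH (size r)) // subnn /= sz' !sub0r mulrC.
rewrite !IH; [|lia|lia].
by case E: (size r - k)%N => [|d]; [lia | rewrite /=; congr (_`_ _ - _); lia].
Qed.

End Trees.

Section Lagrange.
Local Open Scope ring_scope.
Variables (F : fieldType) (x : nat -> F) (n : nat).
Hypothesis x_inj : forall i j, (i < n)%N -> (j < n)%N -> x i = x j -> i = j.

Definition node_poly : {poly F} := \prod_(0 <= i < n) ('X - (x i)%:P).

Lemma node_deriv i : (i < n)%N ->
  (node_poly^`()).[x i] = \prod_(0 <= j < n | j != i) (x i - x j).
Proof.
move=> hi; rewrite /node_poly.
rewrite (bigD1_seq i) ?mem_index_iota ?iota_uniq //=.
rewrite derivM derivXsubC mul1r !hornerE subrr mul0r addr0 horner_prod.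
by apply: eq_bigr => j _; rewrite !hornerE.
Qed.

Lemma node_deriv_neq0 i : (i < n)%N -> (node_poly^`()).[x i] != 0.
Proof.
move=> hi; rewrite node_deriv //.
rewrite prodf_seq_neq0; apply/allP => j; rewrite mem_index_iota => hj.
by apply/implyP; apply: contraNneq => /eqP; rewrite subr_eq0 => /eqP/x_inj ->.
Qed.

(** The derivative of the node polynomial is read off the root of the
    reversed tree. *)
Lemma coef_node_deriv (R : {poly F}) i :
  R = \prod_(0 <= i < n) lin (x i) -> (i < n)%N ->
  (node_poly^`())`_i = R`_(n.-1 - i) *+ i.+1.
Proof.
move=> -> hi; rewrite coef_deriv coef_rev_prod size_iota; last by lia.
congr (_`_ _ *+ _); lia.
Qed.

Lemma node_deriv_size : (size node_poly^`() <= n)%N.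
Proof.
case: (posnP n) => [n0|n0].
  by rewrite /node_poly n0 big_nil derivC size_poly0.
rewrite -ltnS; apply: leq_trans (lt_size_deriv _) _.
  by rewrite monic_neq0 // monic_prod // => i _; apply: monicXsubC.
rewrite /node_poly.
by rewrite size_prod_XsubC size_iota subn0.
Qed.

Lemma lin0 : lin (0 : F) = 1.
Proof. by rewrite /lin scale0r subr0. Qed.

Hypothesis x0 : forall i, (n <= i)%N -> x i = 0.

Lemma prod_lin_wide N (P : pred nat) : (n <= N)%N ->
  \prod_(0 <= j < N | P j) lin (x j) = \prod_(0 <= j < n | P j) lin (x j).
Proof.
move=> nN; rewrite (big_cat_nat (n := n)) //=.
rewrite [X in _ * X]big_nat_cond [X in _ * X]big1 ?mulr1 // => j /andP[/andP[hj _] _].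
by rewrite x0 ?lin0.
Qed.

(** Lagrange's formula, read in the reversed tree: up to the order of its
    coefficients, the root of [stree] is the sum of the
    w_i prod_(j <> i) (X - x_j), a polynomial with the same values as f. *)
Lemma lagrange_coef (w : nat -> F) (f : {poly F}) L k :
  (size f <= n)%N -> (n <= 2 ^ L)%N ->
  (forall i, (i < n)%N -> w i = f.[x i] / (node_poly^`()).[x i]) ->
  (forall i, (n <= i)%N -> w i = 0) -> (k < n)%N ->
  (stree x w L 0)`_(n.-1 - k) = f`_k.
Proof.
move=> sf nL hw hw0 hk.
pose g := \sum_(0 <= i < n) w i *: \prod_(0 <= j < n | j != i) ('X - (x j)%:P).
have sg : (size g <= n)%N.
  rewrite /g big_nat; apply: (leq_trans (size_sum _ _ _)).
  apply/bigmax_leqP_seq => i _ hi; apply: leq_trans (size_scale_leq _ _) _.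
  rewrite -big_filter size_prod_XsubC.
  rewrite size_filter; have := count_predC (pred1 i) (index_iota 0 n).
  rewrite count_uniq_mem ?iota_uniq // mem_index_iota hi /= size_iota.
  rewrite (eq_count (a2 := predC (pred1 i))) //; lia.
have fg : f = g.
  apply/eqP; rewrite -subr_eq0; apply/eqP.
  apply: (roots_geq_poly_eq0 (rs := mkseq x n)).
  - apply/allP => a /mapP[i]; rewrite mem_iota /= add0n => hi ->.
    rewrite /root !hornerE /g horner_sum (bigD1_seq i) ?mem_index_iota ?iota_uniq //=.
    rewrite !hornerE horner_prod hw // (eq_bigr (fun j => x i - x j)); last first.
      by move=> j _; rewrite !hornerE.
    rewrite -node_deriv // divfK ?node_deriv_neq0 //.
    rewrite big_nat_cond big1 ?addr0 ?subrr // => j /andP[hj ji].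
    rewrite !hornerE horner_prod big_mkcond (bigD1_seq i) ?mem_index_iota ?iota_uniq //=.
    by rewrite eq_sym ji !(hornerE, subrr) /= mulr0 mul0r.
  - rewrite /mkseq map_inj_in_uniq ?iota_uniq // => i j; rewrite !mem_iota /= !add0n.
    exact: x_inj.
  - rewrite size_mkseq; apply: leq_trans (size_polyD _ _) _.
    by rewrite size_polyN geq_max sf sg.
rewrite fg streeE mul0n mul1n (big_cat_nat (n := n)) //= addrC.
rewrite big_nat_cond big1 ?add0r; last first.
  by move=> i /andP[/andP[hi _] _]; rewrite hw0 ?scale0r.
rewrite /g !coef_sum; apply: eq_big_nat => i hi.
rewrite !coefZ prod_lin_wide //; congr (_ * _).
rewrite -big_filter -[in RHS]big_filter.
have sz : size [seq j <- index_iota 0 n | j != i] = n.-1.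
  rewrite size_filter; have := count_predC (pred1 i) (index_iota 0 n).
  rewrite count_uniq_mem ?iota_uniq // mem_index_iota hi /= size_iota.
  rewrite (eq_count (a2 := predC (pred1 i))) //; lia.
rewrite coef_rev_prod sz; last by lia.
congr (_`_ _); lia.
Qed.

End Lagrange.

Section Newton.
Local Open Scope ring_scope.
Variable F : fieldType.
Implicit Types (p R H E : {poly F}).

Lemma dvdXnP k p : reflect (forall i, (i < k)%N -> p`_i = 0) ('X^k %| p)%R.
Proof.
apply: (iffP idP) => [/dvdpP[q ->] i hi|h].
  by rewrite coefMXn hi.
rewrite -(poly_take_drop k p) [take_poly k p](_ : _ = 0) ?add0r ?dvdp_mull //.
by apply/polyP => i; rewrite coef_take_poly coef0; case: ifP => // /h.
Qed.

Lemma dvdXn_take N p : ('X^N %| p - take_poly N p)%R.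
Proof. by apply/dvdXnP => i hi; rewrite coefB coef_take_poly hi subrr. Qed.

(** For H an approximation of the opposite of 1 / R, the error 1 + R H is
    squared when H is replaced by H (2 + R H).  Using the opposite of the inverse
    saves the subtractions. *)
Lemma newton_step R H E H' N k : (k <= N)%N ->
  ('X^N %| E - (R * H + 2%:R))%R -> ('X^N %| H' - E * H)%R -> ('X^k %| 1 + R * H)%R ->
  ('X^(minn (2 * k) N) %| 1 + R * H')%R.
Proof.
move=> kN hE hH hk.
(* 1 + R H (2 + R H) is a square; the other two terms are the truncation
   errors of the two products *)
have -> : 1 + R * H' = (1 + R * H) ^+ 2 + R * (H' - E * H)
                        + R * H * (E - (R * H + 2%:R)) by ring.
have dN : ('X^(minn (2 * k) N) %| ('X^N : {poly F}))%R by rewrite dvdp_Pexp2l ?size_polyX // geq_minr.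
rewrite !dvdp_add //; last 2 first.
- by apply: dvdp_mull; apply: dvdp_trans hH.
- by apply: dvdp_mull; apply: dvdp_trans hE.
apply: (@dvdp_trans _ ('X^(2 * k))).
  by rewrite dvdp_Pexp2l ?size_polyX // geq_minl.
by rewrite mulnC exprM dvdp_exp2r.
Qed.

End Newton.

(** * One node of the tree *)

Local Notation "s `_ i" := (nth 0%R s i) : nat_scope.

(** Decides by linear arithmetic the address tests that describe a memory
    after some writes. *)
Ltac dif := repeat first [rewrite ifT; [|by lia] | rewrite ifF; [|by lia]].
(** Looks up the current address in the memory described by [H]. *)
Ltac mem_at H := rewrite H; dif.

Ltac ev E := by rewrite /= ?E /=.
Ltac copy E := apply: run_copy; [ev E | ev E | ev E | ev E | ].

(** The program for products, with natural numbers as cost bounds. *)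
Definition product_program (F : fieldType) (mul : cmd) (mu : nat -> nat) : Prop :=
  forall n (p q : {poly F}), 0 < n -> size p <= n.+1 -> size q <= n.+1 ->
  yields mul [:: n] (mkseq (fun i => p`_i) n.+1 ++ mkseq (fun i => q`_i) n.+1)
    (mu n) (upto (2 * n).+1 (fun i => (p * q)%R`_i)).

Section Subroutines.
Variables (mul : cmd) (mu : nat -> nat) (F : fieldType).
Hypothesis mulP : product_program F mul mu.
Hypothesis mu_ge : forall n, 0 < n -> n <= mu n.
Implicit Types (s : store F) (Q : store F -> Prop) (p q : {poly F}).

Lemma block_cat T (g : nat -> T) a l1 l2 :
  block g a (l1 + l2) = block g a l1 ++ block g (a + l1) l2.
Proof.
rewrite /block /mkseq iotaD map_cat add0n; congr (_ ++ _).
rewrite -[l1 in iota l1]addn0 iotaDl -map_comp; apply: eq_map => i /=.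
by rewrite addnA.
Qed.

Lemma eq_block T (g h : nat -> T) a l : (forall i, i < l -> g (a + i) = h i) ->
  block g a l = mkseq h l.
Proof. by move=> e; apply/eq_in_map => i; rewrite mem_iota => /andP[_ /e]. Qed.

(** The operands must be adjacent in memory; the memory layouts below are
    chosen for that. *)
Lemma run_mul n p q nf nd nld ai li af lf d ld s Q : 0 < n ->
  ieval s li = 1 -> ieval s af = nf -> ieval s lf = 2 * n + 2 ->
  ieval s d = nd -> ieval s ld = nld ->
  imem s (ieval s ai) = n -> size p <= n.+1 -> size q <= n.+1 -> nld <= (2 * n).+1 ->
  (forall i, i < n.+1 -> fmem s (nf + i) = p`_i) ->
  (forall i, i < n.+1 -> fmem s (nf + n.+1 + i) = q`_i) ->
  (forall s', imem s' = imem s -> tabs s' = tabs s ->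
     (forall y, fmem s' y = if nd <= y < nd + nld then (p * q)%R`_(y - nd) else fmem s y) ->
     Q s') ->
  run (Call mul ai li af lf d ld) s
   (icost ai + icost li + icost af + icost lf + icost d + icost ld
       + 1 + (2 * n + 2) + nld + mu n).+1 Q.
Proof.
move=> n0 e1 e2 e3 e4 e5 e6 sp sq hld hp hq hQ.
apply: (run_call (P := upto (2 * n).+1 (fun i => (p * q)%R`_i)) e1 e3 e4 e5 erefl erefl).
  have -> : block (imem s) (ieval s ai) 1 = [:: n] by rewrite /block /mkseq /= addn0 e6.
  rewrite e2.
  have -> : 2 * n + 2 = n.+1 + n.+1 by lia.
  by rewrite block_cat (eq_block hp) (eq_block hq); apply: mulP.
move=> s' w hw i' t' m'; apply: hQ => // y; rewrite m'; case: ifP => // hy.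
by rewrite hw //; lia.
Qed.

Ltac mult E n p q := apply: (run_mul (n := n) (p := p) (q := q));
  [by [] | ev E | ev E | rewrite /= ?E /=; lia | ev E | ev E | ev E
  | lia | lia | lia | | | ].

(** Since cells beyond the source are zeroed, copying enough coefficients
    copies the polynomial, whatever the length of the destination. *)
Lemma run_copy_poly p nsrc nls nd nld src ls dst ld s Q :
  ieval s src = nsrc -> ieval s ls = nls -> ieval s dst = nd -> ieval s ld = nld ->
  size p <= nls -> (forall i, i < nls -> fmem s (nsrc + i) = p`_i) ->
  (forall s', imem s' = imem s -> tabs s' = tabs s ->
     (forall y, fmem s' y = if nd <= y < nd + nld then p`_(y - nd) else fmem s y) ->
     Q s') ->
  run (Copy src ls dst ld) s
   (icost src + icost ls + icost dst + icost ld + nls + nld + 4) Q.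
Proof.
move=> e1 e2 e3 e4 sp hp hQ; apply: (run_copy e1 e2 e3 e4) => s' i' t' m'.
apply: hQ => // y; rewrite m'; case: ifP => // hy; case: ltnP => h; first by rewrite hp.
by rewrite nth_default // (leq_trans sp).
Qed.

Ltac copy_poly E p := apply: (run_copy_poly (p := p));
  [ev E | ev E | ev E | ev E | lia | | ].

(** Input: the numerators of the two children, then their subproducts.  Output:
    the numerator of the parent. *)
Definition Up : cmd :=
  (Copy 0 $0 (4 * $0 + 2) ($0 + 1) ;;
   Copy (3 * $0 + 1) ($0 + 1) (5 * $0 + 3) ($0 + 1) ;;
   Call mul 0 1 (4 * $0 + 2) (2 * $0 + 2) (6 * $0 + 4) (2 * $0) ;;
   Copy $0 $0 (4 * $0 + 2) ($0 + 1) ;;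
   Copy (2 * $0) ($0 + 1) (5 * $0 + 3) ($0 + 1) ;;
   Call mul 0 1 (4 * $0 + 2) (2 * $0 + 2) 0 (2 * $0) ;;
   For 1 (2 * $0) (SetF $1 (FAdd (FLd $1) (FLd (6 * $0 + 4 + $1)))))%P.

Lemma run_Up D (v : seq F) (SL SR RL RR : {poly F}) : 0 < D ->
  size SL <= D -> size SR <= D -> size RL <= D.+1 -> size RR <= D.+1 ->
  (forall y, y < D -> v`_y = SL`_y) ->
  (forall y, D <= y < 2 * D -> v`_y = SR`_(y - D)) ->
  (forall y, 2 * D <= y < 3 * D + 1 -> v`_y = RL`_(y - 2 * D)) ->
  (forall y, 3 * D + 1 <= y < 4 * D + 2 -> v`_y = RR`_(y - (3 * D + 1))) ->
  yields Up [:: D] v (1000 * mu D) (upto (2 * D) (fun i => (SL * RR + SR * RL)%R`_i)).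
Proof.
move=> D0 sSL sSR sRL sRR hSL hSR hRL hRR.
rewrite /yields; set s0 := start _ _.
have i0 : imem s0 = nth 0 [:: D] by [].
have m0 y : fmem s0 y = v`_y by [].
apply: run_le.
  apply: run_seq; copy_poly i0 SL => [i hi|s1 i1 _ m1].
    by rewrite m0 hSL; [congr nth; lia|lia].
  rewrite i0 in i1.
  apply: run_seq; copy_poly i1 RR => [i hi|s2 i2 _ m2].
    by mem_at m1; rewrite m0 hRR; [congr nth; lia|lia].
  rewrite i1 in i2.
  apply: run_seq; mult i2 D SL RR.
  - by move=> i hi; mem_at m2; mem_at m1; congr nth; lia.
  - by move=> i hi; mem_at m2; congr nth; lia.
  move=> s3 i3 _ m3; rewrite i2 in i3.
  apply: run_seq; copy_poly i3 SR => [i hi|s4 i4 _ m4].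
    by mem_at m3; mem_at m2; mem_at m1; rewrite m0 hSR; [congr nth; lia|lia].
  rewrite i3 in i4.
  apply: run_seq; copy_poly i4 RL => [i hi|s5 i5 _ m5].
    by mem_at m4; mem_at m3; mem_at m2; mem_at m1; rewrite m0 hRL; [congr nth; lia|lia].
  rewrite i4 in i5.
  apply: run_seq; mult i5 D SR RL.
  - by move=> i hi; mem_at m5; mem_at m4; congr nth; lia.
  - by move=> i hi; mem_at m5; congr nth; lia.
  move=> s6 i6 _ m6; rewrite i5 in i6.
  apply: (run_for (n := 2 * D) (Inv := fun t s =>
     [/\ imem s 0 = D, imem s 1 = t &
       forall y, fmem s y = if y < t then (SL * RR + SR * RL)%R`_y else fmem s6 y])).
  - by move=> t s _ [e0 e1 _]; rewrite /= e0 e1.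
  - by split=> //=; rewrite i6.
  - move=> t s ht [e0 e1 e2]; apply: run_setf; [by rewrite /= e1 | by rewrite /= e0 e1 |].
    split=> /=; [by rewrite e0 | by rewrite e1 |] => y; have [->|ny] := eqVneq y t.
      dif; rewrite e2 ltnn e2; dif; mem_at m6; rewrite m6; dif.
      mem_at m5; mem_at m4; mem_at m3; rewrite coefD addrC; congr (_ + _)%R; congr nth; lia.
    by rewrite e2; case: (ltnP y t) => h; dif.
  - by move=> s [_ _ e] i hi; rewrite e hi.
have := mu_ge D0; rewrite /=; lia.
Qed.

(** Input: the window of 2 D coefficients kept at the parent, then the
    subproducts of the two children.  Output: the windows of the children.
    Each child is multiplied by the subproduct of the other one. *)
Definition Down : cmd :=
  (SetI 1 (2 * $0) ;;
   Copy 0 $1 (4 * $0 + 2) ($1 + 1) ;;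
   Copy (3 * $0 + 1) ($0 + 1) (6 * $0 + 3) ($1 + 1) ;;
   Call mul 1 1 (4 * $0 + 2) (4 * $0 + 2) (8 * $0 + 4) $1 ;;
   Copy (9 * $0 + 4) $0 0 $0 ;;
   Copy (2 * $0) ($0 + 1) (6 * $0 + 3) ($1 + 1) ;;
   Call mul 1 1 (4 * $0 + 2) (4 * $0 + 2) (8 * $0 + 4) $1 ;;
   Copy (9 * $0 + 4) $0 $0 $0)%P.

Lemma run_Down D (v : seq F) (T RL RR : {poly F}) : 0 < D ->
  size T <= 2 * D -> size RL <= D.+1 -> size RR <= D.+1 ->
  (forall y, y < 2 * D -> v`_y = T`_y) ->
  (forall y, 2 * D <= y < 3 * D + 1 -> v`_y = RL`_(y - 2 * D)) ->
  (forall y, 3 * D + 1 <= y < 4 * D + 2 -> v`_y = RR`_(y - (3 * D + 1))) ->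
  yields Down [:: D] v (1000 * mu (2 * D)) (upto (2 * D) (fun i =>
    if i < D then (T * RR)%R`_(D + i) else (T * RL)%R`_i)).
Proof.
move=> D0 sT sRL sRR hT hRL hRR.
have D20 : 0 < 2 * D by lia.
rewrite /yields; set s0 := start _ _.
have m0 y : fmem s0 y = v`_y by [].
apply: run_le.
  apply: run_seq; apply: run_seti; [by []|by []|cbv beta]; set s1 := set_imem _ _ _.
  have i1 : imem s1 = (fun y => if y == 1 then 2 * D else nth 0 [:: D] y) by [].
  have m1 y : fmem s1 y = v`_y by [].
  clearbody s1.
  apply: run_seq; copy_poly i1 T => [i hi|s2 i2 _ m2]; first by rewrite m1 hT.
  rewrite i1 in i2.
  apply: run_seq; copy_poly i2 RR => [i hi|s3 i3 _ m3].
    by mem_at m2; rewrite m1 hRR; [congr nth; lia|lia].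
  rewrite i2 in i3.
  apply: run_seq; mult i3 (2 * D) T RR.
  - by move=> i hi; mem_at m3; mem_at m2; congr nth; lia.
  - by move=> i hi; mem_at m3; congr nth; lia.
  move=> s4 i4 _ m4; rewrite i3 in i4.
  apply: run_seq; copy i4 => s5 i5 _ m5; rewrite i4 in i5.
  apply: run_seq; copy_poly i5 RL => [i hi|s6 i6 _ m6].
    by mem_at m5; mem_at m4; mem_at m3; mem_at m2; rewrite m1 hRL; [congr nth; lia|lia].
  rewrite i5 in i6.
  apply: run_seq; mult i6 (2 * D) T RL.
  - by move=> i hi; mem_at m6; mem_at m5; mem_at m4; mem_at m3; mem_at m2; congr nth; lia.
  - by move=> i hi; mem_at m6; congr nth; lia.
  move=> s7 i7 _ m7; rewrite i6 in i7.
  copy i7 => s8 i8 _ m8 i hi.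
  case: (ltnP i D) => hD; mem_at m8; mem_at m7; last by congr nth; lia.
  by mem_at m6; mem_at m5; mem_at m4; congr nth; lia.
have := mu_ge D20; rewrite /=; lia.
Qed.

End Subroutines.

Section Levels.
Variable F : fieldType.
Implicit Types (s : store F).

(** Blocks of the same length are disjoint. *)
Lemma in_block B t u k : k < B -> (t * B <= u * B + k < t * B + B) = (u == t).
Proof.
move=> kB; apply/andP/eqP => [[h1 h2]|->]; last by lia.
have h3 : u * B < t.+1 * B by lia.
have h4 : t * B < u.+1 * B by lia.
by move: h3 h4; rewrite !ltn_mul2r; lia.
Qed.

Lemma block_lt B c u k : u < c -> k < B -> u * B + k < c * B.
Proof.
move=> uc kB; have : u.+1 * B <= c * B by rewrite leq_mul2r uc orbT.
lia.
Qed.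

(** Applies [q] to all the nodes of a level in place.  The memory holds the
    [cnt] blocks of length 2 D of the parents, then the subproducts of the
    2 [cnt] children, with D + 1 coefficients each, and a scratch area. *)
Definition Level (q : cmd) : cmd :=
  (For 2 $1 (
     Copy ($2 * (2 * $0)) (2 * $0) ($1 * (4 * $0 + 2)) (2 * $0) ;;
     Copy ($1 * (2 * $0) + $2 * (2 * $0 + 2)) (2 * $0 + 2)
          ($1 * (4 * $0 + 2) + 2 * $0) (2 * $0 + 2) ;;
     Call q 0 1 ($1 * (4 * $0 + 2)) (4 * $0 + 2) ($2 * (2 * $0)) (2 * $0)))%P.

Lemma run_Level (q : cmd) D cnt (v : seq F) K (w : nat -> nat -> F) : 0 < D ->
  (forall u, u < cnt ->
     yields q [:: D] (mkseq (fun k => v`_(u * (2 * D) + k)) (2 * D) ++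
                   mkseq (fun k => v`_(cnt * (2 * D) + u * (2 * D + 2) + k)) (2 * D + 2))
       K (upto (2 * D) (w u))) ->
  yields (Level q) [:: D; cnt] v (cnt * (K + 100 * D + 200) + 20)
    (fun m => forall u k, u < cnt -> k < 2 * D -> m (u * (2 * D) + k) = w u k).
Proof.
move=> D0 hq.
apply: run_le.
  apply: (run_for (n := cnt) (Inv := fun t s =>
     [/\ imem s 0 = D, imem s 1 = cnt, imem s 2 = t,
      forall u k, u < cnt -> k < 2 * D ->
        fmem s (u * (2 * D) + k) = if u < t then w u k else v`_(u * (2 * D) + k)
      & forall y, cnt * (2 * D) <= y < cnt * (4 * D + 2) -> fmem s y = v`_y])).
  - by move=> t s _ [e0 e1 e2 _ _] /=; rewrite e2 e1.
  - by split.
  - move=> t s tc [e0 e1 e2 hlo hhi].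
    have split_addr : cnt * (4 * D + 2) = cnt * (2 * D) + cnt * (2 * D + 2) by lia.
    have hb k : k < 2 * D -> t * (2 * D) + k < cnt * (2 * D) by exact: block_lt.
    have hr k : k < 2 * D + 2 -> t * (2 * D + 2) + k < cnt * (2 * D + 2) by exact: block_lt.
    apply: run_seq; apply: run_copy;
      [by rewrite /= e0 e2|by rewrite /= e0|by rewrite /= e0 e1|by rewrite /= e0|].
    move=> s1 i1 _ m1; rewrite -{}i1 in e0 e1 e2.
    apply: run_seq; apply: run_copy;
      [by rewrite /= e0 e1 e2|by rewrite /= e0|by rewrite /= e0 e1|by rewrite /= e0|].
    move=> s2 i2 _ m2; rewrite -{}i2 in e0 e1 e2.
    apply: (run_call (u := [:: D]) (nli := 1));
      [by []|by rewrite /= e0|by rewrite /= e0 e2|by rewrite /= e0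
       |by rewrite /block /mkseq /= ?addn0 e0| |exact: (hq _ tc)|].
      rewrite /= e0 e1 (_ : 4 * D + 2 = 2 * D + (2 * D + 2)); last by lia.
      rewrite block_cat; congr (_ ++ _); apply: eq_block => i hi.
        have := hb _ hi; set a := t * (2 * D); set b := cnt * _ => hbi.
        mem_at m2; mem_at m1; rewrite (_ : a + _ = a + i); last by lia.
        by rewrite hlo // ltnn.
      have := hr _ hi; set a := t * (2 * D + 2) => hri.
      have hz : cnt * (2 * D) <= cnt * (2 * D) + a + i < cnt * (4 * D + 2) by lia.
      rewrite -(hhi _ hz).
      mem_at m2; mem_at m1; congr fmem; lia.
    move=> s3 w' hw' i3 _ m3; rewrite -{}i3 in e0 e1 e2.
    split=> /=; rewrite ?e0 ?e1 ?e2 //.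
      move=> u k uc hk; rewrite m3 in_block // ltnS leq_eqVlt.
      have := block_lt uc hk => hu.
      have [->|nu] /= := eqVneq u t; first by rewrite addKn hw'.
      by mem_at m2; mem_at m1; rewrite hlo.
    move=> y hy; have := hb (2 * D).-1 ltac:(lia) => ht.
    by mem_at m3; mem_at m2; mem_at m1; rewrite hhi.
  - by move=> s [_ _ _ h _] u k uc hk; rewrite h // uc.
rewrite /=; nia.
Qed.

End Levels.

(** * Power series inverse and product tree *)

Section TreeInv.
Variables (mul : cmd) (mu : nat -> nat) (F : fieldType).
Hypothesis mulP : product_program F mul mu.
Hypothesis mu_ge : forall n, 0 < n -> n <= mu n.
Hypothesis mu_mul : forall k n, 0 < k -> 0 < n -> k * mu n <= mu (k * n).
Implicit Types (s : store F) (Q : store F -> Prop) (p q : {poly F}).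

(** The negated inverse of [R] modulo X^N after [t] steps.  All steps are
    done at full precision: this costs O(M(N) log N) instead of O(M(N)), which
    is within the bound for interpolation. *)
Fixpoint newton (R : {poly F}) N t : {poly F} :=
  if t is t'.+1 then
    take_poly N ((take_poly N (R * newton R N t') + 2%:R%:P) * newton R N t')
  else (- 1)%R.

Lemma size_newton R N t : 0 < N -> size (newton R N t) <= N.
Proof. by case: t => [|t] N0 /=; rewrite ?size_polyN ?size_poly1 // size_take_poly. Qed.

Lemma newtonP (R : {poly F}) L t : R`_0 = 1%R -> t <= L ->
  ('X^(2 ^ t) %| (1 + R * newton R (2 ^ L) t)%R)%R.
Proof.
move=> R0; elim: t => [|t IH] tL.
  apply/dvdXnP => -[] //= _.
  by rewrite mulrN1 coefB coef1 R0 subrr.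
have le2 : 2 ^ t <= 2 ^ L by rewrite leq_exp2l // ltnW.
have := @newton_step _ R (newton R (2 ^ L) t)
  (take_poly (2 ^ L) (R * newton R (2 ^ L) t) + 2%:R%:P)
  (newton R (2 ^ L) t.+1) (2 ^ L) (2 ^ t) le2.
rewrite -expnS (minn_idPl _) ?leq_exp2l //; apply; last exact/IH/ltnW.
- rewrite polyC_natr opprD addrACA subrr addr0 -opprB dvdpNr; exact: dvdXn_take.
- by rewrite -opprB dvdpNr; exact: dvdXn_take.
Qed.

(** Memory: R, H and 2 + R H, each with N + 1 cells.  Both products, of R by
    H and of H by 2 + R H, have adjacent operands, and the result overwrites
    H. *)
Definition Inverse : cmd :=
  (SetF ($0 + 1) (FSub FZero FOne) ;;
   For 2 $1 (
     Call mul 0 1 0 (2 * $0 + 2) (2 * $0 + 2) $0 ;;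
     SetF (2 * $0 + 2) (FAdd (FLd (2 * $0 + 2)) (FAdd FOne FOne)) ;;
     Call mul 0 1 ($0 + 1) (2 * $0 + 2) ($0 + 1) $0) ;;
   Copy ($0 + 1) $0 0 $0)%P.

Lemma run_Inverse L (v : seq F) (R : {poly F}) :
  size R <= (2 ^ L).+1 -> (forall y, v`_y = R`_y) ->
  yields Inverse [:: 2 ^ L; L] v (1000 * L.+1 * mu (2 ^ L))
    (upto (2 ^ L) (fun i => (newton R (2 ^ L) L)`_i)).
Proof.
set N := 2 ^ L => sR hv.
have N0 : 0 < N by rewrite expn_gt0.
have sN t : size (newton R N t) <= N by exact: size_newton.
apply: run_le.
  apply: run_seq; apply: run_setf; [by []|by []|cbv beta].
  apply: run_seq.
  apply: (run_for (n := L) (Inv := fun t s =>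
     [/\ imem s 0 = N, imem s 1 = L, imem s 2 = t,
       forall y, y < N.+1 -> fmem s y = R`_y
      & (forall y, y < N.+1 -> fmem s (N.+1 + y) = (newton R N t)`_y) /\
        fmem s (3 * N + 2) = 0%R])).
  - by move=> t s _ [e0 e1 e2 _ _] /=; rewrite e2 e1.
  - split=> //=.
      by move=> y hy; dif; rewrite hv.
    split=> [y hy|]; last first.
      by dif; rewrite hv nth_default //; apply: leq_trans sR _; lia.
    rewrite coefN coef1 sub0r; case: y hy => [|y] hy; dif => //.
    by rewrite hv nth_default ?oppr0 //; apply: leq_trans sR _; lia.
  - move=> t s tL [e0 e1 e2 hR [hH hz]].
    set E := (take_poly N (R * newton R N t) + 2%:R%:P)%R.
    have sE : size E <= N.+1.
      apply: leq_trans (size_polyD _ _) _; rewrite geq_max size_polyC.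
      by have := size_take_poly N (R * newton R N t)%R; case: (_ == _); lia.
    apply: run_seq; apply: (run_mul mulP (n := N) (p := R) (q := newton R N t));
     [by [] | by [] | by [] | by rewrite /= e0 | by rewrite /= e0 | by rewrite /= e0
     | by [] | by [] | by apply: leq_trans (sN t) _ | lia | by [] | | ].
      by move=> i hi; rewrite add0n hH.
    move=> s1 i1 _ m1; rewrite -{}i1 in e0 e1 e2.
    apply: run_seq; apply: run_setf; [by rewrite /= e0|by rewrite /= e0|].
    apply: (run_mul mulP (n := N) (p := newton R N t) (q := E));
     [by [] | by [] | by rewrite /= e0 | by rewrite /= e0 | by rewrite /= e0 | by rewrite /= e0
     | by [] | by apply: leq_trans (sN t) _ | by [] | lia | | | ].
    - by move=> i hi; rewrite /=; dif; mem_at m1; rewrite addn1 hH.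
    - move=> i hi /=.
      have -> : (N + 1 + N.+1 + i == 2 * N + 2) = (i == 0) by lia.
      rewrite coefD coefC coef_take_poly; case: eqP => [->|hi0].
        by rewrite N0; mem_at m1; congr (_ + _)%R; congr nth; lia.
      rewrite addr0; case: (ltnP i N) => hiN.
        by mem_at m1; congr nth; lia.
      by mem_at m1; rewrite -hz; congr fmem; lia.
    move=> s2 i2 _ m2; split => /=; rewrite ?i2 /= ?e0 ?e1 ?e2 //.
      by move=> y hy; mem_at m2; rewrite /=; dif; mem_at m1; rewrite hR.
    split=> [y hy|]; last by mem_at m2; rewrite /=; dif; mem_at m1.
    rewrite coef_take_poly mulrC; case: (ltnP y N) => hyN.
      by mem_at m2; congr nth; lia.
    mem_at m2; rewrite /=; dif; mem_at m1; rewrite hH //.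
    by rewrite nth_default // (leq_trans (sN t)).
  - move=> s [e0 e1 e2 hR [hH hz]]; apply: run_copy;
      [by rewrite /= e0|by rewrite /= e0|by rewrite /=|by rewrite /= e0|].
    move=> s1 i1 _ m1 i hi; mem_at m1; rewrite -hH; last by lia.
    congr fmem; lia.
have := mu_ge N0; rewrite /=; nia.
Qed.

Variable x : nat -> F.

(** Level [l] occupies 2 N cells, enough for its 2^(L-l) nodes of 2^l + 1
    coefficients.  Siblings are adjacent, ready to be multiplied. *)
Definition tree_level L l (m : nat -> F) := forall v k, v < 2 ^ (L - l) -> k < 2 ^ l + 1 ->
  m (l * (2 * 2 ^ L) + (v * (2 ^ l + 1) + k)) = (ptree x l v)`_k.

Lemma tree_addr L l v k : l <= L -> v < 2 ^ (L - l) -> k < 2 ^ l + 1 ->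
  v * (2 ^ l + 1) + k < 2 * 2 ^ L.
Proof.
move=> lL hv hk; apply: leq_trans (block_lt hv hk) _.
rewrite mulnDr -expnD subnK // muln1 mul2n -addnn leq_add2l leq_exp2l //; lia.
Qed.

(** The points are first moved beyond the space of the tree, which starts at
    address 0 because [Call] returns an initial segment of the memory. *)
Definition Tree : cmd :=
  (Copy 0 $0 (($1 + 1) * (2 * $0)) $0 ;;
   For 2 $0 (
     SetF (2 * $2) FOne ;;
     SetF (2 * $2 + 1) (FSub FZero (FLd (($1 + 1) * (2 * $0) + $2)))) ;;
   SetI 3 1 ;;
   SetI 4 ($0 / 2) ;;
   For 2 $1 (
     For 5 $4 (
       Call mul 3 1 ($2 * (2 * $0) + $5 * (2 * $3 + 2)) (2 * $3 + 2)
         (($2 + 1) * (2 * $0) + $5 * (2 * $3 + 1)) (2 * $3 + 1)) ;;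
     SetI 3 (2 * $3) ;;
     SetI 4 ($4 / 2)))%P.

Lemma run_Tree L (v : seq F) : (forall y, v`_y = x y) ->
  yields Tree [:: 2 ^ L; L] v (1000 * L.+1 * mu (2 ^ L))
    (fun m => forall l, l <= L -> tree_level L l m).
Proof.
set N := 2 ^ L => hv.
have N0 : 0 < N by rewrite expn_gt0.
apply: run_le.
  apply: run_seq; apply: run_copy; [by []|by []|by []|by []|] => s0 i0 _ m0.
  set X0 := (L + 1) * (2 * N).
  have hX : 2 * N <= X0 by rewrite /X0; nia.
  apply: run_seq; apply: (run_for (n := N) (Inv := fun t s =>
     [/\ imem s 0 = N, imem s 1 = L, imem s 2 = t,
       forall y, y < N -> fmem s (X0 + y) = x y
      & forall u k, u < t -> k < 2 -> fmem s (u * 2 + k) = (lin (x u))`_k])).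
  - by move=> t s _ [e0 e1 e2 _ _] /=; rewrite e2 e0.
  - split=> //=; rewrite ?i0 //.
    by move=> y hy; rewrite m0 /=; dif; rewrite hv; congr x; lia.
  - move=> t s tN [e0 e1 e2 hx hl].
    apply: run_seq; apply: run_setf; [by rewrite /= e2|by []|].
    apply: run_setf; [by rewrite /= e2|by []|].
    split=> /=; rewrite ?e0 ?e1 ?e2 //.
      by move=> y hy; dif; rewrite hx.
    move=> u k; rewrite ltnS leq_eqVlt => /orP[/eqP->|ut] hk.
      rewrite /lin coefB coefZ coefX coef1.
      case: k hk => [|[]] // _ /=; dif; first by rewrite mulr0 subr0.
      by rewrite hx // mulr1.
    by dif; rewrite hl.
  move=> s1 [e0 e1 _ _ hl].
  apply: run_seq; apply: run_seti; [by []|by []|].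
  apply: run_seq; apply: run_seti; [by []|by rewrite /= e0|].
  apply: (run_for (n := L) (Inv := fun t s =>
     [/\ imem s 0 = N, imem s 1 = L, imem s 2 = t,
       imem s 3 = 2 ^ t /\ imem s 4 = N %/ 2 ^ t.+1
      & forall l, l <= t -> tree_level L l (fmem s)])).
  - by move=> t s _ [c0 c1 c2 _ _] /=; rewrite c1 c2.
  - split=> //= l; rewrite leqn0 => /eqP-> u k; rewrite subn0 expn0 => hu hk /=.
    by rewrite mul0n add0n hl.
  - move=> t s tL [c0 c1 c2 [c3 c4] ht].
    set D := 2 ^ t in c3; set cnt := N %/ _ in c4.
    have cntE : cnt = 2 ^ (L - t.+1) by rewrite /cnt /N -{1}(subnK tL) expnD mulnK ?expn_gt0.
    have cntD : 2 * (cnt * D) = N.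
      by rewrite cntE mulnCA -expnS -expnD subnK.
    have D0 : 0 < D by rewrite expn_gt0.
    have cnt0 : 0 < cnt by rewrite cntE expn_gt0.
    have cm : 2 * (cnt * mu D) <= mu N.
      by rewrite mulnA -cntD mulnA; apply: mu_mul; rewrite ?muln_gt0 ?cnt0.
    apply: (run_le (K' := 500 * mu N)); last exact: leqnn.
    apply: run_le.
    apply: run_seq; apply: (run_for (n := cnt) (Inv := fun u s =>
     [/\ imem s 0 = N, imem s 1 = L, imem s 2 = t,
       [/\ imem s 3 = D, imem s 4 = cnt & imem s 5 = u]
      & (forall l, l <= t -> tree_level L l (fmem s)) /\
        forall w k, w < u -> k < 2 * D + 1 ->
          fmem s (t.+1 * (2 * N) + (w * (2 * D + 1) + k)) = (ptree x t.+1 w)`_k])).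
    + by move=> u s2 _ [_ _ _ [d3 d4 d5] _] /=; rewrite d4 d5.
    + by split.
    + move=> u s2 hu [d0 d1 d2 [d3 d4 d5] [d6 d7]].
      have u2 : u.*2.+1 < 2 ^ (L - t).
        by rewrite -(subnSK tL) expnS -cntE; lia.
      apply: (run_mul mulP (n := D) (p := ptree x t u.*2) (q := ptree x t u.*2.+1));
       [by [] | by [] | by rewrite /= d0 d2 d3 d5 | by rewrite /= d3
       | by rewrite /= d0 d2 d3 d5 | by rewrite /= d3 | by []
       | exact: size_ptree | exact: size_ptree | by rewrite addn1 | | | ].
      * move=> i hi; rewrite -(d6 t) //; [|exact: ltnW|by rewrite addn1].
        by congr fmem; rewrite -/D -/N; nia.
      * move=> i hi; rewrite -(d6 t) //; [|by rewrite addn1].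
        by congr fmem; rewrite -/D -/N; nia.
      move=> s3 i3 _ m3; split => /=; rewrite ?i3 //; first by rewrite d3 d4 d5.
      have tt : t.+1 * (2 * N) = t * (2 * N) + 2 * N by lia.
      split.
        move=> l lt w k hw hk; rewrite m3 ifF; first by apply: d6.
        have := tree_addr (ltnW (leq_ltn_trans lt tL)) hw hk.
        have : l * (2 * N) <= t * (2 * N) by rewrite leq_mul2r lt orbT.
        by rewrite -/N; lia.
      move=> w k hw hk; rewrite m3 addn1.
      have := in_block u w hk => hb.
      rewrite -addnA leq_add2l ltn_add2l hb.
      case: eqP => [->|nw]; last by apply: d7 => //; lia.
      by congr nth; lia.
    move=> s2 [d0 d1 d2 [d3 d4 d5] [d6 d7]].
    apply: run_seq; apply: run_seti; [by []|by rewrite /= d3|].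
    apply: run_seti; [by []|by rewrite /= d4|].
    split=> /=; rewrite ?d0 ?d1 ?d2 //.
      by rewrite expnS; split=> //; rewrite /cnt [in RHS]expnSr divnMA.
    move=> l; rewrite leq_eqVlt => /orP[/eqP->|]; last by rewrite ltnS; apply: d6.
    by move=> w k hw hk; have := d7 w k; rewrite /D -expnS; apply; rewrite ?cntE.
    have := mu_ge N0; rewrite /=; nia.
  - by move=> s [_ _ _ _ h].
have := mu_ge N0; rewrite /=; nia.
Qed.

End TreeInv.

(** * Univariate interpolation *)

Section Interp.
Variables (mul : cmd) (mu : nat -> nat) (F : fieldType).
Hypothesis mulP : product_program F mul mu.
Hypothesis mu_ge : forall n, 0 < n -> n <= mu n.
Hypothesis mu_mul : forall k n, 0 < k -> 0 < n -> k * mu n <= mu (k * n).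
Implicit Types (s : store F) (Q : store F -> Prop) (p q : {poly F}).

(** Memory of [Interp]: points and values (2 n cells), reversed derivative and
    negated inverse (N + 1 cells each), field counter, leaves (N cells), copy
    of the current level of the tree (2 N cells), tree.  A level is copied
    behind the leaves to form the input of [Level]. *)
Definition pPH : iexp := (2 * $0)%P.
Definition pHH : iexp := (2 * $0 + $1 + 1)%P.
Definition pC0 : iexp := (2 * $0 + 2 * $1 + 2)%P.
Definition pWW : iexp := (2 * $0 + 2 * $1 + 3)%P.
Definition pRS : iexp := (2 * $0 + 3 * $1 + 3)%P.
Definition pT0 : iexp := (2 * $0 + 5 * $1 + 3)%P.

(** N is the least power of two that is at least n, and U its logarithm; they
    are kept in cells 1 and 2. *)
Definition Setup : cmd :=
  (SetI 1 1 ;;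
   For 3 $0 (If ($1 < $0) (SetI 1 (2 * $1) ;; SetI 2 ($2 + 1)) Skip) ;;
   Call (Tree mul) 1 2 0 $0 pT0 (($2 + 1) * (2 * $1)) ;;
   Call (Inverse mul) 1 2 (pT0 + $2 * (2 * $1)) ($1 + 1) pHH $1)%P.

(** Computes the first N coefficients of rev(V') / R.  The field counter at
    [pC0] runs through -1, -2, and so on: its sign cancels that of the negated
    inverse. *)
Definition Quotient : cmd :=
  (For 3 $0 (
     SetF pC0 (FSub (FLd pC0) FOne) ;;
     SetF (pPH + ($1 - 1 - $3))
       (FMul (FLd pC0) (FLd (pT0 + $2 * (2 * $1) + ($0 - 1 - $3))))) ;;
   Call mul 1 1 pPH (2 * $1 + 2) pWW $1)%P.

(** Turn t takes the windows from depth t to depth t + 1; cells 4 and 5 hold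
    the D and cnt of [Level]. *)
Definition Descend : cmd :=
  (SetI 4 $1 ;; SetI 5 1 ;;
   For 3 $2 (
     SetI 4 ($4 / 2) ;;
     Copy (pT0 + ($2 - 1 - $3) * (2 * $1)) (2 * $1) pRS (2 * $1) ;;
     Call (Level (Down mul)) 4 2 pWW (3 * $1) pWW $1 ;;
     SetI 5 (2 * $5)))%P.

(** In the leaves, V'(x_i) is replaced by f(x_i) / V'(x_i); the leaves
    beyond n, which come from padding, get weight 0. *)
Definition Weights : cmd :=
  (For 3 $0 (SetF (pWW + $3) (FDiv (FLd ($0 + $3)) (FLd (pWW + $3)))) ;;
   Copy 0 0 (pWW + $0) ($1 - $0))%P.

Definition Ascend : cmd :=
  (SetI 4 1 ;; SetI 5 ($1 / 2) ;;
   For 3 $2 (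
     Copy (pT0 + $3 * (2 * $1)) (2 * $1) pRS (2 * $1) ;;
     Call (Level (Up mul)) 4 2 pWW (3 * $1) pWW $1 ;;
     SetI 4 (2 * $4) ;;
     SetI 5 ($5 / 2)))%P.

(** The numerator at the root is the reversal of f. *)
Definition Output : cmd :=
  (For 3 $0 (SetF $3 (FLd (pWW + ($0 - 1 - $3)))))%P.

Definition Interp : cmd :=
  (Setup ;; Quotient ;; Descend ;; Weights ;; Ascend ;; Output)%P.

Variables (xs : seq F) (f : {poly F}).
Local Notation n := (size xs).
Local Notation U := (up_log 2 n).
Variable N : nat.
Hypotheses (n0 : 0 < n) (NE : N = 2 ^ U) (xs_uniq : uniq xs) (sf : size f <= n).
Local Notation x := (nth 0%R xs).
Local Notation R := (ptree x U 0).
Local Notation H := (newton R N U).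
Local Notation V' := ((node_poly x n)^`())%R.
Local Notation PH := (2 * n).
Local Notation HH := (2 * n + N + 1).
Local Notation C0 := (2 * n + 2 * N + 2).
Local Notation WW := (2 * n + 2 * N + 3).
Local Notation RS := (2 * n + 3 * N + 3).
Local Notation T0 := (2 * n + 5 * N + 3).

(** What the phases after [Setup] read and do not change: the sizes, the values
    to be interpolated and the product tree. *)
Definition frame s : Prop :=
  [/\ imem s 0 = n, imem s 1 = N, imem s 2 = U,
      forall i, i < n -> fmem s (n + i) = (f.[x i])%R
    & forall l, l <= U -> tree_level x U l (fun y => fmem s (T0 + y))].

Lemma frame_keep s s' : frame s ->
  imem s' 0 = imem s 0 -> imem s' 1 = imem s 1 -> imem s' 2 = imem s 2 ->
  (forall y, (n <= y < 2 * n) || (T0 <= y) -> fmem s' y = fmem s y) -> frame s'.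
Proof.
move=> [e0 e1 e2 hy ht] i0 i1 i2 h; split; rewrite ?i0 ?i1 ?i2 //.
  by move=> i hi; rewrite h ?hy //; lia.
by move=> l lU v k hv hk; rewrite h ?ht //; lia.
Qed.

Lemma N_gt0 : 0 < N. Proof. by rewrite NE expn_gt0. Qed.
Lemma n_le_N : n <= N. Proof. by rewrite NE up_logP. Qed.

Lemma x_inj i j : i < n -> j < n -> x i = x j -> i = j.
Proof. by move=> hi hj /eqP; rewrite nth_uniq // => /eqP. Qed.

Lemma x_out i : n <= i -> x i = 0%R. Proof. exact: nth_default. Qed.

Lemma rootE : R = (\prod_(0 <= i < n) lin (x i))%R.
Proof.
by rewrite ptreeE mul0n mul1n (prod_lin_wide x_out) // -NE n_le_N.
Qed.

Lemma root_coef0 : R`_0 = 1%R.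
Proof.
rewrite rootE; elim/big_ind: _ => [|p q hp hq|i _]; first by rewrite coef1.
  by rewrite coef0M hp hq mulr1.
by rewrite -[lin _]mulr1 coef_linM coef1 mulr0 subr0.
Qed.

Lemma run_Setup : run Setup (start [:: n] (xs ++ [seq f.[a] | a <- xs]%R))
  (3000 * U.+1 * mu N)
  (fun s => [/\ frame s, forall i, i < N.+1 -> fmem s (HH + i) = H`_i,
     forall i, i < N.+1 -> fmem s (PH + i) = 0%R & fmem s C0 = 0%R]).
Proof.
have N0 := N_gt0; have nN := n_le_N.
set s0 := start _ _.
have m0 y : n.*2 <= y -> fmem s0 y = 0%R.
  by move=> hy; rewrite /= nth_default // size_cat size_map; lia.
have my i : i < n -> fmem s0 (n + i) = (f.[x i])%R.
  by move=> hi; rewrite /= nth_cat ltnNge leq_addr addKn (nth_map 0%R).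
have mx i : i < n -> fmem s0 i = x i.
  by move=> hi; rewrite /= nth_cat hi.
apply: run_le.
  apply: run_seq; apply: run_seti; [by rewrite /=|by rewrite /=|cbv beta].
  apply: run_seq; apply: (run_for (n := n) (Inv := fun t s =>
     (* N is doubled as long as it is below n, that is, U times *)
     [/\ imem s 0 = n, imem s 1 = 2 ^ minn t U, imem s 2 = minn t U, imem s 3 = t
       & fmem s = fmem s0])).
  - by move=> t s _ [e0 e1 e2 e3 _] /=; rewrite e0 e3.
  - by split; rewrite //= min0n.
  - move=> t s tn [e0 e1 e2 e3 em].
    have ltE : (2 ^ minn t U < n) = (t < U).
      apply/idP/idP => [h|h].
        rewrite ltnNge; apply/negP => Ut; move: h; rewrite (minn_idPr Ut).
        by rewrite ltnNge up_logP.
      rewrite (minn_idPl (ltnW h)) ltnNge; apply/negP => h'.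
      by have := up_log_min (isT : 1 < 2) h'; lia.
    apply: run_if; rewrite /= e0 e1 -ltnNge ltE => tU.
      apply: run_seq; apply: run_seti; [by rewrite /=|by rewrite /= e1|].
      apply: run_seti; [by rewrite /=|by rewrite /= e2|].
      have -> : minn t.+1 U = (minn t U).+1 by lia.
      by split=> /=; rewrite ?e3 ?addn1 ?expnS.
    apply: run_skip.
    have -> : minn t.+1 U = minn t U by lia.
    by split=> //=; rewrite e3.
  move=> s1 [e0 e1 e2 _ em].
  have Un : U <= n by apply: up_log_min => //; apply: ltnW; exact: ltn_expl.
  rewrite (minn_idPr Un) -NE in e1 e2.
  apply: run_seq; apply: (run_call (u := [:: 2 ^ U; U]) (v := xs) (nli := 2));
   [by rewrite /=|by rewrite /= e0|by rewrite /= e0 e1|by rewrite /= e1 e2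
   |by rewrite /block /mkseq /= ?addn0 e1 e2 NE
   | |exact: (run_Tree (x := x) mulP mu_ge mu_mul)|].
    rewrite em -[RHS](mkseq_nth 0%R); apply: eq_block => i hi.
    exact: mx.
  move=> s2 w hw i2 _ m2; rewrite -{}i2 in e0 e1 e2.
  have hT l : l <= U -> tree_level x U l (fun y => fmem s2 (T0 + y)).
    move=> lU v k hv hk; have := tree_addr lU hv hk; rewrite -NE => ha.
    rewrite m2 ifT.
      by rewrite addKn NE hw.
    have : l * (2 * N) <= U * (2 * N) by rewrite leq_mul2r lU orbT.
    by lia.
  have hR y : y < N.+1 -> fmem s2 (T0 + U * (2 * N) + y) = R`_y.
    move=> hy; rewrite -(hT U) ?subnn -?NE ?addn1 //.
    by congr fmem; lia.
  apply: (run_call (u := [:: 2 ^ U; U]) (nli := 2));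
   [by rewrite /=|by rewrite /= e1|by rewrite /= e0 e1|by rewrite /= e1
   |by rewrite /block /mkseq /= ?addn0 e1 e2 NE
   | |apply: (run_Inverse (R := R) mulP mu_ge)|].
  - by [].
  - exact: size_ptree.
  - move=> y; rewrite nth_block /= e0 e1 e2 addn1.
    case: ltnP => hy; first exact: hR.
    rewrite nth_default //; apply: leq_trans (size_ptree _ _ _) _; rewrite -NE; lia.
  move=> s3 w3 hw3 i3 _ m3.
  split.
  - split; rewrite ?i3 //.
      by move=> i hi; mem_at m3; mem_at m2; rewrite em my.
    by move=> l lU v k hv hk; rewrite m3 ifF ?hT //; lia.
  - move=> i hi; rewrite m3; case: (ltnP i N) => hiN.
      dif; rewrite addKn hw3 -?NE //.
    dif; mem_at m2; rewrite em m0 ?nth_default //; last by lia.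
    exact: leq_trans (size_newton _ _ N0) _.
  - by move=> i hi; mem_at m3; mem_at m2; rewrite em m0; [|lia].
  - by mem_at m3; mem_at m2; rewrite em m0; [|lia].
have := mu_ge N0; rewrite -NE /=; nia.
Qed.

(** The opposite of the reversal of V' in degree N - 1; for the true degree
    n - 1 this includes a shift by N - n. *)
Definition revderiv : {poly F} := (\poly_(k < N) - V'`_(N.-1 - k))%R.

Lemma run_Quotient s : frame s -> (forall i, i < N.+1 -> fmem s (HH + i) = H`_i) ->
  (forall i, i < N.+1 -> fmem s (PH + i) = 0%R) -> fmem s C0 = 0%R ->
  run Quotient s (1000 * mu N) (fun s' => frame s' /\
    forall k, k < N -> fmem s' (WW + k) = (revderiv * H)%R`_k).
Proof.
move=> fr0 hH hP hC; have N0 := N_gt0; have nN := n_le_N.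
apply: run_le.
  apply: run_seq; apply: (run_for (n := n) (Inv := fun t s =>
     [/\ frame s, imem s 3 = t, forall i, i < N.+1 -> fmem s (HH + i) = H`_i,
       fmem s C0 = (- t%:R)%R
     & forall i, i < N.+1 -> fmem s (PH + i) =
         if N <= i + t then revderiv`_i else 0%R])).
  - by move=> t s1 _ [[e0 _ _ _ _] e3 _ _ _] /=; rewrite e0 e3.
  - split=> //=.
      by rewrite hC oppr0.
    move=> i hi; rewrite hP // addn0; case: leqP => // Ni.
    by rewrite nth_default // (leq_trans (size_poly _ _)).
  - move=> t s1 tn [fr e3 hH1 hC1 hP1]; have [e0 e1 e2 hy ht] := fr.
    apply: run_seq; apply: run_setf; [by rewrite /= e0 e1|by rewrite /= e0 e1|].
    have aR : fmem s1 (T0 + U * (2 * N) + (n - 1 - t)) = R`_(n - 1 - t).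
      have := ht U (leqnn _) 0 (n - 1 - t).
      by rewrite subnn -NE mul0n add0n => <- //; [congr fmem|]; lia.
    apply: run_setf; [by rewrite /= e0 e1 e3|rewrite /= e0 e1 e2 e3; dif; rewrite aR; reflexivity|].
    split=> /=; rewrite ?e3 //.
    - by apply: frame_keep fr _ _ _ _ => //= y hy'; dif.
    - by move=> i hi; dif; rewrite hH1.
    - by dif; rewrite hC1 -natr1 opprD.
    move=> i hi; have [ei|ni] := eqVneq (PH + i) (PH + (N - 1 - t)); last first.
      dif; rewrite hP1 //; case: (ltnP (i + t.+1) N) => h1; dif => //.
    rewrite ifT; last by lia.
    have -> : i = N - 1 - t by lia.
    rewrite hC1 coef_poly ifT; last by lia.
    rewrite (coef_node_deriv rootE) //; last by lia.
    have -> : N.-1 - (N - 1 - t) = t by lia.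
    by rewrite -opprD natr1 mulNr mulr_natl subn1.
  move=> s1 [fr e3 hH1 hC1 hP1]; have [e0 e1 e2 _ _] := fr.
  apply: (run_mul mulP (n := N) (p := revderiv) (q := H));
    [by [] | by rewrite /= | by rewrite /= e0 | by rewrite /= e1 | by rewrite /= e0 e1
    | by rewrite /= e1 | by rewrite /= e1
    | by apply: leq_trans (size_poly _ _) _ | by apply: leq_trans (size_newton _ _ N0) _
    | lia | | | ].
  - move=> i hi; rewrite hP1 //; case: ltnP => // h1.
    rewrite coef_poly; case: ifP => // h2.
    (* cells that the loop has not reached hold coefficients of V' of degree
       at least n, which vanish *)
    rewrite [_`_(N.-1 - i)]nth_default ?oppr0 //.
    by apply: leq_trans (node_deriv_size _ _) _; lia.
  - by move=> i hi; rewrite -hH1 //; congr fmem; lia.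
  move=> s2 i2 _ m2; split.
    by apply: frame_keep fr _ _ _ _; rewrite ?i2 // => y hy; mem_at m2.
  by move=> k hk; mem_at m2; rewrite addKn.
have := mu_ge N0; rewrite /=; lia.
Qed.

Lemma coefM_short p q D m : size q <= D.+1 -> D <= m ->
  (p * q)%R`_m = (\sum_(j < D.+1) p`_(m - j) * q`_j)%R.
Proof.
move=> sq Dm; rewrite coefMr -(subnK (_ : D.+1 <= m.+1)) ?ltnS // addnC.
rewrite big_split_ord /= [X in (_ + X)%R]big1 ?addr0 // => j _.
by rewrite [q`__]nth_default ?mulr0 // (leq_trans sq) // leq_addr.
Qed.

(** Multiplying by q of degree at most D only mixes coefficients at distance
    at most D: of 2 D known consecutive coefficients of p, the upper half
    determines D coefficients of p q. *)
Lemma coef_window p q D i : 2 * D <= N -> size q <= D.+1 -> i < D ->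
  ((\poly_(k < 2 * D) p`_(N - 2 * D + k)) * q)%R`_(D + i) = (p * q)%R`_(N - D + i).
Proof.
move=> DN sq hi; rewrite !(coefM_short _ sq); try lia.
apply: eq_bigr => j _; have := ltn_ord j => hj.
rewrite coef_poly ifT; last by lia.
by congr (_ * _)%R; congr nth; lia.
Qed.

Lemma nth_block_cat T (z : T) (g h : nat -> T) a b y :
  nth z (mkseq g a ++ mkseq h b) y =
    if y < a then g y else if y - a < b then h (y - a) else z.
Proof.
rewrite nth_cat size_mkseq; case: ltnP => hy; first by rewrite nth_mkseq.
case: ltnP => hb; first by rewrite nth_mkseq.
by rewrite nth_default // size_mkseq.
Qed.

Definition top : {poly F} := (revderiv * H)%R.

Lemma run_Descend s : frame s -> (forall k, k < N -> fmem s (WW + k) = top`_k) ->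
  run Descend s (4000 * U.+1 * mu N) (fun s' => frame s' /\
    forall v, v < N -> fmem s' (WW + v) = (utree x top U U v)`_N.-1).
Proof.
move=> fr0 hT; have N0 := N_gt0; have nN := n_le_N.
have [e0 e1 e2 _ _] := fr0.
apply: run_le.
  apply: run_seq; apply: run_seti; [by rewrite /=|by rewrite /= e1|].
  apply: run_seq; apply: run_seti; [by rewrite /=|by rewrite /=|].
  apply: (run_for (n := U) (Inv := fun t s =>
     [/\ frame s, imem s 3 = t, imem s 4 = 2 ^ (U - t), imem s 5 = 2 ^ t
     & forall v k, v < 2 ^ t -> k < 2 ^ (U - t) ->
         fmem s (WW + (v * 2 ^ (U - t) + k))
           = (utree x top U t v)`_(N - 2 ^ (U - t) + k)])).
  - by move=> t s1 _ [[_ _ d2 _ _] d3 _ _ _] /=; rewrite d2 d3.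
  - split=> //=; first by rewrite subn0.
    by move=> v k; rewrite subn0 expn0 -NE subnn => hv hk; rewrite -hT //; congr fmem; lia.
  - move=> t s1 tU [fr d3 d4 d5 hW]; have [d0 d1 d2 _ ht] := fr.
    apply: (run_le (K' := 3000 * mu N)); last exact: leqnn.
    set l := U - t.+1; set D := 2 ^ l; set cnt := 2 ^ t.
    have D2 : 2 ^ (U - t) = 2 * D by rewrite /D /l -expnS subnSK.
    have cntD : cnt * (2 * D) = N by rewrite -D2 -expnD subnKC // ltnW.
    have D0 : 0 < D by rewrite expn_gt0.
    have cnt0 : 0 < cnt by rewrite expn_gt0.
    have lU : l <= U by rewrite leq_subr.
    have Ul : 2 ^ (U - l) = 2 * cnt by rewrite -expnS /l; congr (2 ^ _); lia.
    have cm : cnt * mu (2 * D) <= mu N by rewrite -cntD; apply: mu_mul => //; lia.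
    have DN : 2 * D <= N by rewrite -cntD leq_pmull.
    rewrite {}D2 in d4 hW.
    apply: run_le.
    apply: run_seq; apply: run_seti; [by rewrite /=|by rewrite /= d4 mulKn|].
    apply: run_seq; apply: run_copy;
      [by rewrite /= d0 d1 d2 d3|by rewrite /= d1|by rewrite /= d0 d1|by rewrite /= d1|].
    move=> s2 /= i2 _ m2; rewrite (_ : U - 1 - t = l) in m2; last by rewrite /l; lia.
    have hRR w k : w < 2 * cnt -> k < D + 1 ->
        fmem s2 (RS + (w * (D + 1) + k)) = (ptree x l w)`_k.
      move=> hw hk; rewrite -Ul in hw; have := tree_addr lU hw hk; rewrite -NE => ha.
      mem_at m2; rewrite -(ht _ lU) // -NE; congr fmem; lia.
    have hW2 y : y < N -> fmem s2 (WW + y) = fmem s1 (WW + y).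
      by move=> hy; mem_at m2.
    apply: run_seq.
    apply: (run_call (u := [:: D; cnt]) (nli := 2));
     [by rewrite /=|by rewrite /= i2 /= d1|by rewrite /= i2 /= d0 d1|by rewrite /= i2 /= d1
     |by rewrite /block /mkseq /= i2 /= ?addn0 d5
     |reflexivity| |].
      apply: (run_Level (w := fun u k => if k < D
          then (utree x top U t.+1 (2 * u))`_(N - D + k)
          else (utree x top U t.+1 (2 * u).+1)`_(N - D + (k - D))) (K := 1000 * mu (2 * D))) => //.
      move=> u hu.
      pose T := (\poly_(k < 2 * D) (utree x top U t u)`_(N - 2 * D + k))%R.
      have hb k : k < 2 * D -> u * (2 * D) + k < N.
        by move=> hk; rewrite -cntD; apply: block_lt.
      have hr k : k < 2 * D + 2 -> u * (2 * D + 2) + k < 2 * N.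
        move=> hk; apply: leq_trans (block_lt hu hk) _; rewrite -cntD; nia.
      apply: run_post.
        apply: (@run_Down _ _ _ mulP mu_ge D _ T (ptree x l (2 * u)) (ptree x l (2 * u).+1));
          [by []|exact: size_poly|exact: size_ptree|exact: size_ptree| | | ].
        - move=> y hy; rewrite nth_block_cat hy coef_poly hy nth_block.
          have := hb _ hy => hy'; rewrite ifT; last by lia.
          by rewrite /= i2 /= d0 d1 hW2 // hW.
        - move=> y hy; rewrite nth_block_cat; dif; rewrite nth_block cntD.
          have := hr (y - 2 * D) ltac:(lia) => hy'; rewrite ifT; last by lia.
          rewrite -hRR; [|lia|lia].
          by rewrite /= i2 /= d0 d1; congr fmem; lia.
        - move=> y hy; rewrite nth_block_cat; dif; rewrite nth_block cntD.
          have := hr (y - 2 * D) ltac:(lia) => hy'; rewrite ifT; last by lia.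
          rewrite -hRR; [|lia|lia].
          by rewrite /= i2 /= d0 d1; congr fmem; lia.
      move=> s3 hs i hi; rewrite hs //.
      have h1 : (2 * u)./2 = u by lia.
      have h2 : (2 * u).+1./2 = u by lia.
      have uS v : utree x top U t.+1 v = (utree x top U t v./2 * ptree x l (sibling v))%R by [].
      rewrite !uS h1 h2 /sibling /= mul2n odd_double /=.
      case: ltnP => hiD; first by rewrite coef_window // size_ptree.
      by rewrite -{1}(subnKC hiD) coef_window ?size_ptree //; lia.
    move=> s3 w hw i3 _ m3.
    apply: run_seti; [by rewrite /=|by rewrite /= i3 i2 /= d5|].
    split=> /=; rewrite ?i3 ?i2 //=.
    - apply: frame_keep fr _ _ _ _; rewrite /= ?i3 ?i2 //= => y hy.
      by mem_at m3; mem_at m2.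
    - by rewrite d3.
    - by rewrite expnS.
    move=> v k hv hk; rewrite -/l -/D -/(utree _ _ _ _ _).
    have hv2 : v./2 < cnt by rewrite expnS in hv; rewrite /cnt; lia.
    have hk2 : odd v * D + k < 2 * D by case: (odd v); lia.
    have hvk : v * D + k = v./2 * (2 * D) + (odd v * D + k).
      by rewrite -{1}(odd_double_half v); lia.
    have := block_lt hv2 hk2; rewrite cntD => ha.
    rewrite hvk; mem_at m3; rewrite addKn hw //.
    case ov: (odd v) hk2 hvk; rewrite ?mul1n ?mul0n ?add0n => hk2 hvk; dif.
      have -> : (2 * v./2).+1 = v by lia.
      by congr nth; lia.
    by have -> : 2 * v./2 = v by lia.
    have cntN : cnt <= N by rewrite -cntD leq_pmulr //; lia.
    have -> : cnt * (1000 * mu (2 * D) + 100 * D + 200)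
       = 1000 * (cnt * mu (2 * D)) + 50 * (cnt * (2 * D)) + 200 * cnt by ring.
    have := mu_ge N0; rewrite cntD /=; lia.
  - move=> s1 [fr _ _ _ hW]; split=> // v hv.
    by have := hW v 0; rewrite subnn expn0 -NE muln1 !addn0 subn1; apply.
have := mu_ge N0; rewrite /=; nia.
Qed.

(** [newton] inverts the root modulo X^N. *)
Lemma root_window k : k < N -> (R * top)%R`_k = (- revderiv)%R`_k.
Proof.
move=> hk; have /dvdXnP/(_ k) := newtonP root_coef0 (leqnn U); rewrite -NE => h.
have -> : (R * top = - revderiv + revderiv * (1 + R * H))%R by rewrite /top; ring.
rewrite coefD [X in (_ + X)%R](_ : _ = 0%R) ?addr0 //.
rewrite coefM big1 // => j _.
have /dvdXnP/(_ (k - j)) := newtonP root_coef0 (leqnn U); rewrite -NE => ->; rewrite ?mulr0 //.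
exact: leq_ltn_trans (leq_subr _ _) hk.
Qed.

Lemma leafE v : v < n -> (utree x top U U v)`_N.-1 = (V'.[x v])%R.
Proof.
have N0 := N_gt0; have nN := n_le_N => hv.
apply: (leaf_eval (p := (- revderiv)%R) N0).
- exact: leq_trans (node_deriv_size _ _) nN.
- move=> k hk; rewrite -root_window //.
  have := @ptree_mul_utree _ x top U U v (leqnn _); rewrite subnn /= => -> //.
  by rewrite -NE; lia.
- move=> i hi; rewrite coefN coef_poly ifT; last by lia.
  by rewrite opprK; congr nth; lia.
Qed.

Definition weight i : F := if i < n then (f.[x i] / V'.[x i])%R else 0%R.

Lemma run_Weights s : frame s ->
  (forall v, v < N -> fmem s (WW + v) = (utree x top U U v)`_N.-1) ->
  run Weights s (100 * mu N) (fun s' => frame s' /\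
    forall v, v < N -> fmem s' (WW + v) = weight v).
Proof.
move=> fr0 hT; have N0 := N_gt0; have nN := n_le_N.
apply: run_le.
  apply: run_seq; apply: (run_for (n := n) (Inv := fun t s =>
     [/\ frame s, imem s 3 = t & forall v, v < n -> fmem s (WW + v) =
         if v < t then weight v else (V'.[x v])%R])).
  - by move=> t s1 _ [[e0 _ _ _ _] e3 _] /=; rewrite e0 e3.
  - by split=> //= v hv; rewrite hT ?leafE //; lia.
  - move=> t s1 tn [fr e3 hW]; have [e0 e1 e2 hy _] := fr.
    apply: (run_setf (v := weight t)); [by rewrite /= e0 e1 e3|
      by rewrite /= e0 e1 e3 hW // ltnn hy // /weight tn|].
    split=> /=; rewrite ?e3 //.
      by apply: frame_keep fr _ _ _ _ => //= y hy'; dif.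
    move=> v hv; rewrite eqn_add2l ltnS leq_eqVlt.
    by have [->|nv] /= := eqVneq v t; [|rewrite hW].
  move=> s1 [fr e3 hW]; have [e0 e1 e2 hy _] := fr.
  apply: run_copy;
   [by rewrite /=|by rewrite /=|by rewrite /= e0 e1|by rewrite /= e0 e1|].
  move=> s2 i2 _ m2; split.
    by apply: frame_keep fr _ _ _ _; rewrite ?i2 // => y hy'; mem_at m2.
  move=> v hv; case: (ltnP v n) => hvn; first by mem_at m2; rewrite hW // hvn.
  by mem_at m2; rewrite /weight ltnNge hvn.
have := mu_ge N0; rewrite /=; lia.
Qed.

Lemma run_Ascend s : frame s -> (forall v, v < N -> fmem s (WW + v) = weight v) ->
  run Ascend s (4000 * U.+1 * mu N) (fun s' => frame s' /\
    forall k, k < N -> fmem s' (WW + k) = (stree x weight U 0)`_k).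
Proof.
move=> fr0 hT; have N0 := N_gt0; have nN := n_le_N.
have [e0 e1 e2 _ _] := fr0.
apply: run_le.
  apply: run_seq; apply: run_seti; [by rewrite /=|by rewrite /=|].
  apply: run_seq; apply: run_seti; [by rewrite /=|by rewrite /= e1|].
  apply: (run_for (n := U) (Inv := fun t s =>
     [/\ frame s, imem s 3 = t, imem s 4 = 2 ^ t, imem s 5 = N %/ 2 ^ t.+1
     & forall v k, v < 2 ^ (U - t) -> k < 2 ^ t ->
         fmem s (WW + (v * 2 ^ t + k)) = (stree x weight t v)`_k])).
  - by move=> t s1 _ [[_ _ d2 _ _] d3 _ _ _] /=; rewrite d2 d3.
  - split=> //= v [|//]; rewrite subn0 -NE => hv _.
    by rewrite coefC eqxx expn0 muln1 addn0 hT.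
  - move=> t s1 tU [fr d3 d4 d5 hW]; have [d0 d1 d2 _ ht] := fr.
    apply: (run_le (K' := 3000 * mu N)); last exact: leqnn.
    set D := 2 ^ t; set cnt := 2 ^ (U - t.+1).
    have cntD : cnt * (2 * D) = N by rewrite -expnS -expnD subnK.
    have cntE : N %/ 2 ^ t.+1 = cnt by rewrite -cntD expnS mulnK // muln_gt0 expn_gt0.
    have D0 : 0 < D by rewrite expn_gt0.
    have cnt0 : 0 < cnt by rewrite expn_gt0.
    have Ut : 2 ^ (U - t) = 2 * cnt by rewrite -expnS subnSK.
    have cm : 2 * (cnt * mu D) <= mu N.
      by rewrite mulnA -cntD mulnCA mulnA; apply: mu_mul => //; lia.
    rewrite {}Ut in hW; rewrite {}cntE in d5.
    have tU' := ltnW tU.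
    apply: run_le.
    apply: run_seq; apply: run_copy;
      [by rewrite /= d0 d1 d3|by rewrite /= d1|by rewrite /= d0 d1|by rewrite /= d1|].
    move=> s2 /= i2 _ m2.
    have hRR w k : w < 2 * cnt -> k < D + 1 ->
        fmem s2 (RS + (w * (D + 1) + k)) = (ptree x t w)`_k.
      move=> hw hk; have hw' : w < 2 ^ (U - t) by rewrite -(subnSK tU) expnS.
      have := tree_addr tU' hw' hk; rewrite -NE => ha.
      by mem_at m2; rewrite -(ht _ tU') // -NE; congr fmem; lia.
    have hW2 y : y < N -> fmem s2 (WW + y) = fmem s1 (WW + y).
      by move=> hy; mem_at m2.
    apply: run_seq.
    apply: (run_call (u := [:: D; cnt]) (nli := 2));
     [by rewrite /=|by rewrite /= i2 /= d1|by rewrite /= i2 /= d0 d1|by rewrite /= i2 /= d1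
     |by rewrite /block /mkseq /= i2 /= ?addn0 d4 d5
     |reflexivity| |].
      apply: (run_Level (w := fun u k => (stree x weight t.+1 u)`_k) (K := 1000 * mu D)) => //.
      move=> u hu.
      have hb k : k < 2 * D -> u * (2 * D) + k < N.
        by move=> hk; rewrite -cntD; apply: block_lt.
      have hr k : k < 2 * D + 2 -> u * (2 * D + 2) + k < 2 * N.
        move=> hk; apply: leq_trans (block_lt hu hk) _; rewrite -cntD; nia.
      apply: (run_Up (SL := stree x weight t u.*2) (SR := stree x weight t u.*2.+1)
               (RL := ptree x t u.*2) (RR := ptree x t u.*2.+1) mulP mu_ge);
        [by []|exact: size_stree|exact: size_stree|exact: size_ptree|exact: size_ptree| | | | ].
      - move=> y hy; rewrite nth_block_cat; dif; rewrite nth_block.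
        have := hb y ltac:(lia) => hy'; rewrite ifT; last by lia.
        rewrite /= i2 /= d0 d1 hW2 // -hW; [|lia|lia].
        by congr fmem; rewrite -/D; lia.
      - move=> y hy; rewrite nth_block_cat; dif; rewrite nth_block.
        have := hb y ltac:(lia) => hy'; rewrite ifT; last by lia.
        rewrite /= i2 /= d0 d1 hW2 // -hW; [|lia|lia].
        by congr fmem; rewrite -/D; lia.
      - move=> y hy; rewrite nth_block_cat; dif; rewrite nth_block cntD.
        have := hr (y - 2 * D) ltac:(lia) => hy'; rewrite ifT; last by lia.
        rewrite -hRR; [|lia|lia].
        by rewrite /= i2 /= d0 d1; congr fmem; lia.
      - move=> y hy; rewrite nth_block_cat; dif; rewrite nth_block cntD.
        have := hr (y - 2 * D) ltac:(lia) => hy'; rewrite ifT; last by lia.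
        rewrite -hRR; [|lia|lia].
        by rewrite /= i2 /= d0 d1; congr fmem; lia.
    move=> s3 w hw i3 _ m3.
    apply: run_seq; apply: run_seti; [by rewrite /=|by rewrite /= i3 i2 /= d4|].
    apply: run_seti; [by rewrite /=|by rewrite /= i3 i2 /= d5|].
    split; rewrite /= ?i3 ?i2 /=.
    - apply: frame_keep fr _ _ _ _; rewrite /= ?i3 ?i2 //= => y hy.
      by mem_at m3; mem_at m2.
    - by rewrite d3.
    - by rewrite expnS.
    - by rewrite -cntD [2 ^ t.+2]expnSr -expnS divnMA mulnK // expn_gt0.
    move=> v k hv; rewrite expnS -/D => hk.
    have := block_lt hv hk; rewrite -/cnt cntD => ha.
    by mem_at m3; rewrite addKn hw.
    have cntN : cnt <= N by rewrite -cntD leq_pmulr //; lia.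
    have -> : cnt * (1000 * mu D + 100 * D + 200)
       = 1000 * (cnt * mu D) + 50 * (cnt * (2 * D)) + 200 * cnt by ring.
    have := mu_ge N0; rewrite cntD /=; lia.
  - move=> s1 [fr _ _ _ hW]; split=> // k hk.
    by have := hW 0 k; rewrite subnn expn0 -NE mul0n add0n; apply.
have := mu_ge N0; rewrite /=; nia.
Qed.

Lemma run_Output s : frame s ->
  (forall k, k < N -> fmem s (WW + k) = (stree x weight U 0)`_k) ->
  run Output s (100 * mu N) (fun s' => forall k, k < n -> fmem s' k = f`_k).
Proof.
move=> [e0 e1 _ _ _] hT; have N0 := N_gt0; have nN := n_le_N.
apply: run_le.
  apply: (run_for (n := n) (Inv := fun t s =>
     [/\ imem s 0 = n, imem s 1 = N, imem s 3 = t,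
       forall k, k < N -> fmem s (WW + k) = (stree x weight U 0)`_k
     & forall k, k < t -> fmem s k = f`_k])).
  - by move=> t s1 _ [d0 _ d3 _ _] /=; rewrite d0 d3.
  - by [].
  - move=> t s1 tn [d0 d1 d3 hW hf].
    apply: (run_setf (v := f`_t)).
    + by rewrite /= d3.
    + rewrite /= d0 d1 d3 hW; last by lia.
      rewrite subn1; apply: (lagrange_coef x_inj x_out) => //; first by rewrite -NE.
        by move=> i hi; rewrite /weight hi.
      by move=> i hi; rewrite /weight ltnNge hi.
    split=> /=; rewrite ?d3 //.
      by move=> k hk; dif; rewrite hW.
    move=> k; rewrite ltnS leq_eqVlt.
    by have [->|nk] /= := eqVneq k t; [|exact: hf].
  - by move=> s1 [].
have := mu_ge N0; rewrite /=; lia.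
Qed.

Lemma run_Interp :
  yields Interp [:: n] (xs ++ [seq f.[a] | a <- xs]%R) (20 * (1000 * U.+1 * mu N))
    (upto n (fun k => f`_k)).
Proof.
have N0 := N_gt0.
apply: run_le.
  apply: run_seq; apply: run_post run_Setup _ => s1 [fr1 hH hP hC].
  apply: run_seq; apply: run_post (run_Quotient fr1 hH hP hC) _ => s2 [fr2 hT].
  apply: run_seq; apply: run_post (run_Descend fr2 hT) _ => s3 [fr3 hL].
  apply: run_seq; apply: run_post (run_Weights fr3 hL) _ => s4 [fr4 hW].
  apply: run_seq; apply: run_post (run_Ascend fr4 hW) _ => s5 [fr5 hS].
  exact: run_Output.
have := mu_ge N0; nia.
Qed.

End Interp.

(** * Codes on maximal semi-grids *)

Section Points.
Local Open Scope ring_scope.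
Variable F : finFieldType.
Implicit Types (P s : seq (F * F)) (al : F) (f g : {poly {poly F}}).

(** The X-coordinates in the order in which they first occur, which is how
    the program numbers the columns; [undup] keeps last occurrences, hence the
    two reversals. *)
Definition firsts s : seq F := rev (undup (rev [seq p.1 | p <- s])).
Definition fibre s al : seq (F * F) := [seq p <- s | p.1 == al].

Lemma firsts_uniq s : uniq (firsts s).
Proof. by rewrite rev_uniq undup_uniq. Qed.

Lemma mem_firsts s : firsts s =i [seq p.1 | p <- s].
Proof. by move=> x; rewrite mem_rev mem_undup mem_rev. Qed.

Lemma firsts_rcons s p :
  firsts (rcons s p) = if p.1 \in firsts s then firsts s else rcons (firsts s) p.1.
Proof.
rewrite mem_firsts /firsts map_rcons rev_rcons /= mem_rev.
by case: ifP => _ //; rewrite rev_cons.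
Qed.

Lemma fibre_rcons s p al :
  fibre (rcons s p) al = if p.1 == al then rcons (fibre s al) p else fibre s al.
Proof. by rewrite /fibre filter_rcons. Qed.

Lemma fibre_nil s al : al \notin firsts s -> fibre s al = [::].
Proof.
rewrite mem_firsts => h; apply/eqP; rewrite -[_ == _]negbK -has_filter.
by apply: contra h => /hasP[p ps /eqP <-]; apply: map_f.
Qed.

Lemma size_firsts P : size (firsts P) = nX P.
Proof.
rewrite /nX -(card_uniqP (firsts_uniq P)); apply: eq_card => x.
rewrite mem_firsts; apply/mapP/imsetP => -[p hp ->]; by exists p.
Qed.

Lemma fibre_snd_uniq P al : uniq P -> uniq [seq p.2 | p <- fibre P al].
Proof.
move=> uP; rewrite map_inj_in_uniq ?filter_uniq // => p q.
rewrite !mem_filter => /andP[/eqP p1 _] /andP[/eqP q1 _] pq.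
by case: p q p1 q1 pq => [? ?] [? ?] /= -> -> ->.
Qed.

Lemma size_fibre P al : uniq P -> size (fibre P al) = #|Yset P al|.
Proof.
move=> uP; rewrite -(size_map snd) -(card_uniqP (fibre_snd_uniq al uP)).
apply: eq_card => y; rewrite inE; apply/mapP/idP => [[[a' y']]|h].
  by rewrite mem_filter => /andP[/eqP /= <-] ? ->.
by exists (al, y); rewrite // mem_filter eqxx.
Qed.

(** Double counting. *)
Lemma size_fibres P (K : seq F) : uniq K -> {subset [seq p.1 | p <- P] <= K} ->
  size P = (\sum_(al <- K) size (fibre P al))%N.
Proof.
move=> uK; elim: P => [|p P IH] /= sub; first by rewrite big1.
rewrite IH => [|x hx]; last by apply: sub; rewrite inE hx orbT.
have pK : p.1 \in K by apply: sub; rewrite mem_head.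
rewrite [LHS](_ : _ = (\sum_(al <- K) (p.1 == al) + \sum_(al <- K) size (fibre P al))%N).
  by rewrite -big_split; apply: eq_bigr => al _; rewrite /fibre /=; case: ifP.
rewrite -add1n; congr addn.
by rewrite (bigD1_seq p.1) //= eqxx big1 // => al /negPf; rewrite eq_sym => ->.
Qed.

(** The coefficient of Y^j, as a polynomial in X. *)
Definition ycoef f j : {poly F} := \poly_(i < size f) f`_i`_j.

Lemma coef_ycoef f j i : (ycoef f j)`_i = f`_i`_j.
Proof.
rewrite coef_poly; case: ltnP => // h.
by rewrite [f`_i]nth_default // coef0.
Qed.

Lemma horner_ycoef f j al : (ycoef f j).[al] = f.[al%:P]`_j.
Proof.
rewrite horner_poly horner_coef coef_sum; apply: eq_bigr => i _.
by rewrite -polyC_exp coefMC.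
Qed.

End Points.

Section CodeTheory.
Local Open Scope ring_scope.
Variables (F : finFieldType) (a b m : nat) (H : {poly {poly F}}) (P : seq (F * F)).
Hypothesis code : maximal_semi_grid_code a b H P m.
Implicit Types (f g q : {poly {poly F}}).

Definition in_span f := forall i j, supp f i j -> (i, j) \in basisB a b m.

Lemma code_a_gt0 : (0 < a)%N.
Proof. by case: code => -[[]]. Qed.

Lemma code_uniq : uniq P.
Proof. by case: code => _ []. Qed.

(** The column of an X-coordinate that occurs is not empty, so its size is
    the common one. *)
Lemma fibre_full al : al \in firsts P -> size (fibre P al) = a.
Proof.
case: code => _ [uP _] sg <- _ h; rewrite size_fibre //.
case: (sg al) => // /eqP; rewrite -size_fibre // size_eq0 => /eqP h0.
move: h; rewrite mem_firsts => /mapP[p pP e].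
have : p \in fibre P al by rewrite mem_filter e eqxx.
by rewrite h0.
Qed.

Lemma code_size : size P = (nX P * a)%N.
Proof.
rewrite (size_fibres (firsts_uniq P)); last by move=> x; rewrite mem_firsts.
rewrite big_seq (eq_bigr (fun=> a)) => [|al /fibre_full //].
by rewrite -big_seq big_const_seq count_predT size_firsts iter_addn_0 mulnC.
Qed.

(** This is where m < n enters. *)
Lemma code_deg : (m %/ a < nX P)%N.
Proof. by rewrite ltn_divLR ?code_a_gt0 // -code_size; case: code. Qed.

Lemma mem_basisB i j : ((i, j) \in basisB a b m) =
  [&& i <= m %/ a, j < a & a * i + b * j <= m]%N.
Proof.
rewrite mem_filter andbC andbA; congr (_ && _).
apply/allpairsPdep/andP => [[i' [j' []]]|[h1 h2]].
  by rewrite !mem_iota /= !add0n ltnS => h1 h2 [-> ->].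
by exists i, j; rewrite !mem_iota /= !add0n ltnS.
Qed.

Lemma in_span_coef f i j : in_span f -> ~~ [&& i <= m %/ a, j < a & a * i + b * j <= m]%N ->
  f`_i`_j = 0.
Proof.
by move=> hf; rewrite -mem_basisB => h; apply/eqP; apply: contraNT h; apply: hf.
Qed.

Lemma in_span_sizeX f : in_span f -> (size f <= nX P)%N.
Proof.
move=> hf; apply/leq_sizeP => i hi; apply/polyP => j; rewrite coef0.
by apply: in_span_coef => //; have := code_deg; lia.
Qed.

Lemma in_span_sizeY f al : in_span f -> (size f.[al%:P] <= a)%N.
Proof.
move=> hf; apply/leq_sizeP => j hj; rewrite -horner_ycoef.
suff -> : ycoef f j = 0 by rewrite horner0.
apply/polyP => i; rewrite coef_ycoef coef0.
by apply: in_span_coef => //; lia.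
Qed.

Lemma in_span_standard f : in_span f -> standard_form a f.
Proof. by move=> hf i j /hf; rewrite mem_basisB => /and3P[]. Qed.

(** The two rounds of interpolation: functions with the same values agree on
    each column, since they have Y-degree below a; then the coefficients of
    each Y^j agree, since they have X-degree below n_X. *)
Lemma in_span_inj f g : in_span f -> in_span g -> ev P f = ev P g -> f = g.
Proof.
move=> hf hg efg.
have key h1 h2 : in_span h1 -> in_span h2 -> ev P h1 = ev P h2 ->
    forall al, al \in firsts P -> h1.[al%:P] = h2.[al%:P].
  move=> s1 s2 e12 al hal; apply/eqP; rewrite -subr_eq0; apply/eqP.
  apply: (roots_geq_poly_eq0 (rs := [seq p.2 | p <- fibre P al])).
  - apply/allP => y /mapP[p]; rewrite mem_filter => /andP[/eqP p1 pP ->].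
    rewrite /root hornerD hornerN subr_eq0 -p1.
    by have /eq_in_map -> := e12.
  - by rewrite fibre_snd_uniq // code_uniq.
  - rewrite size_map fibre_full //; apply: leq_trans (size_polyD _ _) _.
    by rewrite size_polyN geq_max !in_span_sizeY.
apply/polyP => i; apply/polyP => j; rewrite -!coef_ycoef; congr (_`_ _).
congr polyseq.
apply/eqP; rewrite -subr_eq0; apply/eqP.
apply: (roots_geq_poly_eq0 (rs := firsts P)).
- apply/allP => al hal; rewrite /root hornerD hornerN !horner_ycoef.
  by rewrite (key f g) // subrr.
- exact: firsts_uniq.
- rewrite size_firsts; apply: leq_trans (size_polyD _ _) _.
  rewrite size_polyN geq_max; apply/andP; split; apply: leq_trans (size_poly _ _) _;
    exact: in_span_sizeX.
Qed.

Lemma ev_eq_mod f g : eq_mod H f g -> ev P f = ev P g.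
Proof.
case=> q e; apply/eq_in_map => p pP; apply/eqP; rewrite -subr_eq0.
rewrite -[f](subrK g) e !hornerD addrK.
by rewrite !hornerM; case: code => _ [_ /(_ p pP) ->]; rewrite mulr0.
Qed.

Lemma standard_size f : standard_form a f -> (size (swapXY f) <= a)%N.
Proof.
move=> sf; apply/leq_sizeP => j hj; apply/polyP => i; rewrite coef_swapXY coef0.
by apply/eqP/negPn/negP => /sf; rewrite ltnNge hj.
Qed.

(** H contains Y^a, and a i + b j <= a b forces j <= a. *)
Lemma size_curve : size (swapXY H) = a.+1.
Proof.
case: code => -[[a0 b0 _ _] [_ hYa] hdeg _] _ _ _ _.
apply/eqP; rewrite eqn_leq; apply/andP; split.
  apply/leq_sizeP => j hj; apply/polyP => i; rewrite coef_swapXY coef0.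
  by apply/eqP/negPn/negP => /hdeg; nia.
rewrite ltnNge; apply/negP => /leq_sizeP /(_ a (leqnn _)) e.
by move: hYa; rewrite /supp -coef_swapXY e coef0 eqxx.
Qed.

(** A nonzero multiple of H has Y-degree at least a. *)
Lemma standard_unique f g :
  standard_form a f -> standard_form a g -> eq_mod H f g -> f = g.
Proof.
move=> sf sg [q e]; apply/eqP; rewrite -subr_eq0.
have [q0|nq] := eqVneq q 0; first by rewrite e q0 mul0r.
have sq : swapXY q != 0 by rewrite swapXY_eq0.
have sH : swapXY H != 0 by rewrite -size_poly_eq0 size_curve.
have : (size (swapXY (f - g)) <= a)%N.
  rewrite raddfB /=; apply: leq_trans (size_polyD _ _) _.
  by rewrite size_polyN geq_max !standard_size.
rewrite e rmorphM /= size_mul // size_curve addnS /=.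
by rewrite -[X in (_ <= X)%N]add0n leq_add2r leqn0 size_poly_eq0 (negPf sq).
Qed.

End CodeTheory.

(** * The unencoding program *)

Section Unencode.
Variables (mul : cmd) (mu : nat -> nat) (F : finFieldType).
Hypothesis mulP : product_program F mul mu.
Hypothesis mu_ge : forall n, 0 < n -> n <= mu n.
Hypothesis mu_mul : forall k n, 0 < k -> 0 < n -> k * mu n <= mu (k * n).
Implicit Types (s : store F).

(** Table 0 maps an X-coordinate to the number of its column, counted from 1
    since 0 stands for an absent key.  Column number r fills its next free
    places, counted in integer cell 20 + r: the Y-coordinates from
    3 n + 2 a (r - 1) on, followed by the values of the codeword.  These
    2 a cells are the input of [Interp].  The X-coordinates are listed from
    5 n on, and cell 4 counts them. *)
Definition Group : cmd :=
  (For 5 $3 (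
     Lookup 6 0 (FLd (2 * $5)) ;;
     If ($6 <= 0)
       (SetI 4 ($4 + 1) ;; SetI 6 $4 ;; Insert 0 (FLd (2 * $5)) $6 ;;
        SetF (5 * $3 + ($6 - 1)) (FLd (2 * $5)))
       Skip ;;
     SetF (3 * $3 + (($6 - 1) * (2 * $0) + ILd (20 + $6))) (FLd (2 * $5 + 1)) ;;
     SetF (3 * $3 + (($6 - 1) * (2 * $0) + ($0 + ILd (20 + $6)))) (FLd (2 * $3 + $5)) ;;
     SetI (20 + $6) (ILd (20 + $6) + 1)))%P.

(** Writes the coefficients of f(al, Y), a per column, from 6 n on. *)
Definition Columns : cmd :=
  (For 5 $4 (
     Call (Interp mul) 0 1 (3 * $3 + $5 * (2 * $0)) (2 * $0) (6 * $3 + $5 * $0) $0))%P.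

(** For each j, gathers the coefficients of Y^j over all columns behind a copy
    of the X-coordinates, and interpolates them in X. *)
Definition Rows : cmd :=
  (Copy (5 * $3) $4 (7 * $3) $4 ;;
   For 5 $0 (
     For 6 $4 (SetF (7 * $3 + $4 + $6) (FLd (6 * $3 + ($6 * $0 + $5)))) ;;
     Call (Interp mul) 4 1 (7 * $3) (2 * $4) (9 * $3 + $5 * $4) $4))%P.

(** The loops run through the exponents in the order of the basis. *)
Definition Emit : cmd :=
  (SetI 8 0 ;;
   For 5 ($2 / $0 + 1) (
     For 6 $0 (
       If ($0 * $5 + $1 * $6 <= $2)
         (SetF $8 (FLd (9 * $3 + ($6 * $4 + $5))) ;; SetI 8 ($8 + 1))
         Skip)))%P.

Definition Unencode : cmd := (Group ;; Columns ;; Rows ;; Emit)%P.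

Definition interp_cost n : nat := 20 * (1000 * (up_log 2 n).+1 * mu (2 ^ up_log 2 n)).

Lemma interp_cost_ge n : 0 < n -> n <= interp_cost n.
Proof.
move=> n0; have h := up_logP n (isT : 1 < 2).
have h2 : 2 ^ up_log 2 n <= mu (2 ^ up_log 2 n) by apply: mu_ge; rewrite expn_gt0.
by rewrite /interp_cost; nia.
Qed.

Lemma Interp_correct n (ys : seq F) (q : {poly F}) : size ys = n -> 0 < n -> uniq ys ->
  size q <= n ->
  yields (Interp mul) [:: n] (ys ++ [seq q.[y]%R | y <- ys]) (interp_cost n)
    (upto n (fun k => q`_k)).
Proof.
by move=> <- n0 uy sq; apply: run_Interp.
Qed.

Variables (a b m : nat) (H : {poly {poly F}}) (P : seq (F * F)) (f : {poly {poly F}}).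
Hypotheses (code : maximal_semi_grid_code a b H P m) (hf : in_span a b m f).
Local Notation n := (size P).
Local Notation z0 := ((0%R, 0%R) : F * F).
Local Notation g := (nX P).
Local Notation v := (input_data a b H P (ev P f)).

Lemma inputE i : i < n -> [/\ v`_(2 * i) = (nth z0 P i).1,
  v`_(2 * i + 1) = (nth z0 P i).2
  & v`_(2 * n + i) =
     (f.[(nth z0 P i).1%:P].[(nth z0 P i).2])%R].
Proof.
move=> hi; rewrite /input_data.
have sz (s : seq (F * F)) : size (flatten [seq [:: p.1; p.2] | p <- s]) = 2 * size s.
  by elim: s => //= p s ->; lia.
have fl (s : seq (F * F)) : i < size s ->
    (flatten [seq [:: p.1; p.2] | p <- s])`_(2 * i) = (nth z0 s i).1 /\
    (flatten [seq [:: p.1; p.2] | p <- s])`_(2 * i + 1) = (nth z0 s i).2.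
  elim: s i {hi} => // p s IH [|i] // hi.
  by rewrite (_ : 2 * i.+1 = (2 * i).+2); [exact: IH | lia].
have [f1 f2] := fl P hi.
split; last first.
  rewrite nth_cat sz ltnNge leq_addr /= addKn nth_cat size_map hi.
  by rewrite (nth_map z0).
all: rewrite nth_cat sz; rewrite ifT; last by lia.
all: by [].
Qed.

(** [K] lists the X-coordinates of the columns in use and [s0] the points that
    have been placed; they are separate because a column is opened before its
    first point is placed. *)
Definition grouped (K : seq F) (s0 : seq (F * F)) s : Prop :=
  [/\ [/\ imem s 0 = a, imem s 1 = b, imem s 2 = m, imem s 3 = n & imem s 4 = size K],
   (forall al, tabs s 0 al = if al \in K then (index al K).+1 else 0),
   (forall r, imem s (21 + r) = if r < size K then size (fibre s0 (K`_r)) else 0) /\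
   (forall r, r < size K -> fmem s (5 * n + r) = K`_r),
   (forall r t, r < size K -> t < size (fibre s0 (K`_r)) ->
     let p := nth z0 (fibre s0 (K`_r)) t in
     fmem s (3 * n + (r * (2 * a) + t)) = p.2 /\
     fmem s (3 * n + (r * (2 * a) + (a + t))) = (f.[p.1%:P].[p.2])%R)
   & forall y, y < 3 * n -> fmem s y = v`_y].

Lemma size_fibre_take i al : size (fibre (take i P) al) <= a.
Proof.
have le : size (fibre (take i P) al) <= size (fibre P al).
  by rewrite !size_filter -[X in _ <= count _ X](cat_take_drop i) count_cat leq_addr.
apply: leq_trans le _.
have [h|h] := boolP (al \in firsts P); first by rewrite (fibre_full code h).
by rewrite fibre_nil.
Qed.

Lemma size_firsts_take i : size (firsts (take i P)) <= g.
Proof.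
rewrite -size_firsts; apply: uniq_leq_size; first exact: firsts_uniq.
move=> x; rewrite !mem_firsts => /mapP[p /mem_take hp ->].
exact: map_f.
Qed.

Lemma run_Group : run Group (start [:: a; b; m; n] v) (1000 * (n + 1))
  (grouped (firsts P) P).
Proof.
have a0 := code_a_gt0 code; have nga := code_size code.
apply: run_le.
  apply: (run_for (n := n) (Inv := fun t s =>
    grouped (firsts (take t P)) (take t P) s /\ imem s 5 = t)).
  - by move=> t s _ [[[_ _ _ e3 _] _ _ _ _] e5] /=; rewrite e3 e5.
  - by rewrite take0; split=> //; split.
  - move=> t s tn [].
    rewrite (take_nth z0 tn).
    have [vx vy vc] := inputE tn.
    set p : F * F := nth z0 P t in vx vy vc *; set s0 := take t P.
    have K0g := size_firsts_take t; rewrite -/s0 in K0g.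
    have K1g := size_firsts_take t.+1.
    rewrite (take_nth z0 tn) -/s0 -/p in K1g.
    have cs al : size (fibre (rcons s0 p) al) <= a.
      by have := size_fibre_take t.+1 al; rewrite (take_nth z0 tn).
    have fib_lt al : p.1 = al -> size (fibre s0 al) < a.
      by move=> e; have := cs al; rewrite fibre_rcons e eqxx size_rcons.
    move=> gr e5; have [[e0 e1 e2 e3 e4] eT [eC eX] eE ev] := gr.
    apply: run_seq.
    (* the column of the point is looked up, and opened if it is new; the
       points that are placed remain the same *)
    have tE : tabs s (ieval s 0) (feval s (FLd (2 * $5)%P)) =
      if p.1 \in firsts s0 then (index p.1 (firsts s0)).+1 else 0.
      by rewrite /= e5 ev ?vx ?eT //; lia.
    apply: run_lookup; [by rewrite /=|exact: tE|].
    set K := firsts (rcons s0 p); set r := index p.1 K.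
    apply: run_seq; apply: (run_post (Q' := fun s => [/\ grouped K s0 s, imem s 5 = t & imem s 6 = r.+1])).
      apply: run_if => /=.
        case: ifP => // hp _.
        have KE : K = rcons (firsts s0) p.1 by rewrite /K firsts_rcons hp.
        have rE : r = size (firsts s0).
          by rewrite /r KE -cats1 index_cat hp /= eqxx addn0.
        apply: run_seq; apply: run_seti; [by rewrite /=|by rewrite /= e4 addn1|].
        apply: run_seq; apply: run_seti; [by rewrite /=|by rewrite /=|].
        apply: run_seq; apply: run_insert; [by rewrite /=|by rewrite /= e5 ev ?vx //; lia|by rewrite /=|].
        apply: run_setf; [by rewrite /= e3 subn1 /=|by rewrite /= e5 ev ?vx //; lia|].
        split; rewrite /= ?rE //.
        have szK : size K = (size (firsts s0)).+1 by rewrite KE size_rcons.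
        rewrite szK in K1g.
        have s5 : size (firsts s0) < n by apply: leq_trans K1g _; rewrite nga leq_pmulr.
        split=> /=; rewrite ?szK //.
        + move=> al; rewrite eT KE mem_rcons inE -cats1 index_cat /=.
          by have [->|ne] /= := eqVneq al p.1; [rewrite hp ?eqxx addn0|case: ifP].
        + split=> q.
            rewrite eC; have [->|nq] := eqVneq q (size (firsts s0)).
              by rewrite ltnn ltnS leqnn KE nth_rcons ltnn eqxx fibre_nil // hp.
            rewrite ltnS [q <= _]leq_eqVlt (negPf nq) /= KE nth_rcons.
            by case: ltnP.
          rewrite ltnS leq_eqVlt => hq.
          rewrite KE nth_rcons eqn_add2l.
          have [->|nq] := eqVneq q (size (firsts s0)); first by rewrite ltnn.
          by rewrite (negPf nq) /= in hq; rewrite hq eX.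
        + move=> q u hq; rewrite KE nth_rcons.
          have [->|nq] := eqVneq q (size (firsts s0)).
            by rewrite ltnn (fibre_nil (negbT hp)).
          have hq' : q < size (firsts s0) by lia.
          rewrite hq' => hu.
          have ua : u < a by apply: leq_trans hu (size_fibre_take t _).
          have := @block_lt (2 * a) g q (a + u) ltac:(lia) ltac:(lia) => hb.
          by dif; exact: eE.
        + by move=> y hy; dif; exact: ev.
      case: ifP => // hp _; apply: run_skip.
      rewrite /r /K firsts_rcons hp; split=> //=; rewrite ?hp //.
    clear s gr e5 e0 e1 e2 e3 e4 eT eC eX eE ev tE.
    move=> s [[[e0 e1 e2 e3 e4] eT [eC eX] eE ev] e5 e6].
    (* the point is put in the next free place of its column, which exists
       because a column has at most a points *)
    have pK : p.1 \in K by rewrite mem_firsts map_rcons mem_rcons mem_head.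
    have rK : r < size K by rewrite index_mem.
    have Kr : K`_r = p.1 by rewrite nth_index.
    have hc : size (fibre s0 p.1) < a by exact: fib_lt.
    have Ku : uniq K by exact: firsts_uniq.
    have s0a al : size (fibre s0 al) <= a by exact: size_fibre_take.
    have K1g' : size K <= g by [].
    clear K0g K1g cs fib_lt pK; clearbody r K s0 p.
    have e7 : imem s (20 + r.+1) = size (fibre s0 p.1) by rewrite addnS -addSn eC rK Kr.
    have hb : r * (2 * a) + (a + size (fibre s0 p.1)) < 2 * n.
      by rewrite nga [2 * (g * a)]mulnCA; apply: block_lt; lia.
    apply: run_seq; apply: run_setf;
      [by rewrite /= e0 e3 e6 e7 subn1 /=|by rewrite /= e5 ev ?vy //; lia|].
    apply: run_seq; apply: run_setf;
      [by rewrite /= e0 e3 e6 e7 subn1 /=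
      |by rewrite /= e3 e5; dif; rewrite ev ?vc //; lia|].
    apply: run_seti; [by rewrite /= e6|by rewrite /= e6 e7 addn1|].
    split; last by rewrite /= e5.
    split=> /=.
    + by split.
    + by [].
    + split=> q; last by move=> hq; dif; exact: eX.
      rewrite (_ : (21 + q == 20 + r.+1) = (q == r)); last by lia.
      rewrite fibre_rcons eC.
      have [->|nq] := eqVneq q r; first by rewrite rK Kr eqxx size_rcons.
      case: ifP => // hq; case: eqP => // e.
      by case/eqP: nq; apply/eqP; rewrite -(nth_uniq 0%R hq rK) // -e Kr.
    + move=> q u hq; rewrite fibre_rcons.
      have hb2 w : w < 2 * a -> (r * (2 * a) <= q * (2 * a) + w < r * (2 * a) + 2 * a) = (q == r).
        by move=> hw; apply: in_block.
      have [eq|nq] := eqVneq q r.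
        rewrite eq Kr eqxx size_rcons ltnS leq_eqVlt nth_rcons => hu.
        have [->|nu] := eqVneq u (size (fibre s0 p.1)).
          by rewrite ltnn; dif.
        have hu' : u < size (fibre s0 p.1) by lia.
        rewrite hu'; have := eE q u hq; rewrite eq Kr => /(_ hu') [h1 h2].
        by split; dif.
      have -> : (p.1 == K`_q) = false.
        by apply: contraNF nq => /eqP e; rewrite -(nth_uniq 0%R hq rK) // -e Kr.
      move=> hu; have ua : u < a by apply: leq_trans hu (s0a _).
      have h1 := hb2 u ltac:(lia); have h2 := hb2 (a + u) ltac:(lia).
      by have [h3 h4] := eE q u hq hu; split; dif.
    + by move=> y hy; dif; exact: ev.
  - by move=> s []; rewrite take_size.
rewrite /=; nia.
Qed.

Definition columns s : Prop :=
  [/\ [/\ imem s 0 = a, imem s 1 = b, imem s 2 = m, imem s 3 = n & imem s 4 = g],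
   forall r, r < g -> fmem s (5 * n + r) = (firsts P)`_r
   & forall r j, r < g -> j < a ->
     fmem s (6 * n + (r * a + j)) = (f.[((firsts P)`_r)%:P])%R`_j].

Lemma run_Columns s : grouped (firsts P) P s ->
  run Columns s (200 * (g * interp_cost a) + 100) columns.
Proof.
rewrite /grouped size_firsts => -[[e0 e1 e2 e3 e4] _ [_ eX] eE _].
have a0 := code_a_gt0 code; have nga := code_size code.
apply: run_le.
  apply: (run_for (n := g) (Inv := fun t s1 =>
    [/\ [/\ imem s1 0 = a, imem s1 1 = b, imem s1 2 = m, imem s1 3 = n & imem s1 4 = g],
      imem s1 5 = t, forall y, y < 6 * n -> fmem s1 y = fmem s y
      & forall r j, r < t -> j < a ->
        fmem s1 (6 * n + (r * a + j)) = (f.[((firsts P)`_r)%:P])%R`_j])).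
  - by move=> t s1 _ [[_ _ _ _ d4] d5 _ _] /=; rewrite d4 d5.
  - by split.
  - move=> t s1 tg [[d0 d1 d2 d3 d4] d5 hlo hhi].
    set al := (firsts P)`_t.
    have hal : al \in firsts P by rewrite mem_nth // size_firsts.
    have sal := fibre_full code hal.
    pose ys := [seq p.2 | p <- fibre P al].
    apply: (run_call (u := [:: a]) (nli := 1)
               (v := ys ++ [seq (f.[al%:P].[y])%R | y <- ys]));
     [by rewrite /=|by rewrite /= d0|by rewrite /= d0 d3 d5|by rewrite /= d0
     |by rewrite /block /mkseq /= ?addn0 d0
     | |apply: Interp_correct => //|].
    + rewrite mul2n -addnn block_cat.
      have ha k : k < 2 * a -> t * (2 * a) + k < 2 * n.
        by move=> hk; rewrite nga [2 * (g * a)]mulnCA; apply: block_lt.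
      have hE k : k < a -> _ := fun hk => eE t k tg (leq_trans hk (eq_leq (esym sal))).
      congr (_ ++ _).
        rewrite (eq_block (h := fun k => ys`_k)).
          by rewrite -[in RHS](mkseq_nth 0%R ys) /ys size_map sal.
        move=> k hk; rewrite (nth_map z0) ?sal // -(hE k hk).1 /= d0 d3 d5 hlo; last first.
          by have := ha k ltac:(lia); lia.
        by congr fmem; lia.
      rewrite (eq_block (h := fun k => [seq (f.[al%:P].[y])%R | y <- ys]`_k)).
        by rewrite -[in RHS](mkseq_nth 0%R [seq _ | y <- ys]) !size_map sal.
      move=> k hk; rewrite (nth_map 0%R) ?size_map ?sal // (nth_map z0) ?sal //.
      have : nth z0 (fibre P al) k \in fibre P al by rewrite mem_nth // sal.
      rewrite mem_filter => /andP[/eqP e1' _].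
      have [_ h2] := hE k hk; rewrite -/al e1' in h2; rewrite -{}h2 /= d0 d3 d5 hlo; last first.
        by have := ha (a + k) ltac:(lia); lia.
      by congr fmem; lia.
    + by rewrite size_map.
    + by rewrite fibre_snd_uniq // (code_uniq code).
    + exact: in_span_sizeY hf.
    move=> s2 w hw i2 _ m2; split; rewrite /= ?i2 ?d5 //.
      by move=> y hy; mem_at m2; exact: hlo.
    move=> r j; rewrite ltnS => hr hj.
    rewrite m2 -addnA leq_add2l ltn_add2l in_block //.
    have [->|nr] := eqVneq r t; last by apply: hhi => //; lia.
    by rewrite hw; [congr nth|]; lia.
  - move=> s1 [h1 _ hlo hhi]; split=> // r hr; rewrite hlo ?eX //.
    have : g <= n by rewrite nga leq_pmulr.
    lia.
have := interp_cost_ge a0; rewrite /=; nia.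
Qed.

Definition rows s : Prop :=
  [/\ imem s 0 = a, imem s 1 = b, imem s 2 = m, imem s 3 = n /\ imem s 4 = g
   & forall j i, j < a -> i < g -> fmem s (9 * n + (j * g + i)) = f`_i`_j].

Lemma run_Rows s : columns s -> run Rows s (200 * (a * interp_cost g) + 100) rows.
Proof.
case=> -[e0 e1 e2 e3 e4] eX eC.
have a0 := code_a_gt0 code; have nga := code_size code.
have g0 : 0 < g by apply: leq_ltn_trans (code_deg code).
have gn : g <= n by rewrite nga leq_pmulr.
apply: run_le.
  apply: run_seq; apply: run_copy;
    [by rewrite /= e3|by rewrite /= e4|by rewrite /= e3|by rewrite /= e4|].
  move=> s0 i0 _ m0; rewrite -{}i0 in e0 e1 e2 e3 e4.
  have hX r : r < g -> fmem s0 (7 * n + r) = (firsts P)`_r.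
    by move=> hr; mem_at m0; rewrite -eX //; congr fmem; lia.
  have hC r j : r < g -> j < a -> fmem s0 (6 * n + (r * a + j)) = (f.[((firsts P)`_r)%:P])%R`_j.
    move=> hr hj; have := block_lt hr hj; rewrite -nga => h.
    by mem_at m0; exact: eC.
  clear eX eC m0 s.
  apply: (run_for (n := a) (Inv := fun t s1 =>
    [/\ [/\ imem s1 0 = a, imem s1 1 = b, imem s1 2 = m, imem s1 3 = n & imem s1 4 = g],
      imem s1 5 = t, forall y, y < 7 * n + g -> fmem s1 y = fmem s0 y
      & forall j i, j < t -> i < g -> fmem s1 (9 * n + (j * g + i)) = f`_i`_j])).
  - by move=> t s1 _ [[d0 _ _ _ _] d5 _ _] /=; rewrite d0 d5.
  - by split.
  - move=> t s1 ta [[d0 d1 d2 d3 d4] d5 hlo hhi].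
    apply: (run_le (K' := 100 * interp_cost g)); last exact: leqnn.
    apply: run_le.
    apply: run_seq; apply: (run_for (n := g) (Inv := fun r s2 =>
      [/\ [/\ imem s2 0 = a, imem s2 1 = b, imem s2 2 = m, imem s2 3 = n & imem s2 4 = g],
        imem s2 5 = t /\ imem s2 6 = r,
        forall y, y < 7 * n + g -> fmem s2 y = fmem s0 y,
        forall y, 7 * n + g + g <= y -> fmem s2 y = fmem s1 y
        & forall q, q < r -> fmem s2 (7 * n + g + q) = (f.[((firsts P)`_q)%:P])%R`_t])).
    + by move=> r s2 _ [[_ _ _ _ c4] [_ c6] _ _ _] /=; rewrite c4 c6.
    + by split.
    + move=> r s2 rg [[c0 c1 c2 c3 c4] [c5 c6] glo ghi gmid].
      have hra := block_lt rg ta; rewrite -nga in hra.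
      apply: run_setf; [by rewrite /= c3 c4 c6|
        by rewrite /= c0 c3 c5 c6 glo ?hC //; lia|].
      split=> /=; rewrite ?c6 //.
      * by move=> y hy; dif; exact: glo.
      * by move=> y hy; dif; exact: ghi.
      move=> q; rewrite ltnS leq_eqVlt eqn_add2l.
      by have [->|nq] := eqVneq q r; [|exact: gmid].
    move=> s2 [[c0 c1 c2 c3 c4] [c5 c6] glo ghi gmid].
    apply: (run_call (u := [:: g]) (nli := 1)
               (v := firsts P ++ [seq (ycoef f t).[y]%R | y <- firsts P]));
     [by rewrite /=|by rewrite /= c4|by rewrite /= c3 c4 c5|by rewrite /= c4
     |by rewrite /block /mkseq /= ?addn0 c4
     | |apply: Interp_correct => //|].
    + rewrite mul2n -addnn block_cat; congr (_ ++ _).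
        rewrite (eq_block (h := fun k => (firsts P)`_k)).
          by rewrite -[in RHS](mkseq_nth 0%R (firsts P)) size_firsts.
        by move=> k hk; rewrite /= c3 glo ?hX //; lia.
      rewrite (eq_block (h := fun k => [seq (ycoef f t).[y]%R | y <- firsts P]`_k)).
        by rewrite -[in RHS](mkseq_nth 0%R [seq _ | y <- _]) !size_map size_firsts.
      move=> k hk; rewrite (nth_map 0%R) ?size_firsts // horner_ycoef -gmid //.
      by rewrite /= c3.
    + exact: size_firsts.
    + exact: firsts_uniq.
    + by apply: leq_trans (size_poly _ _) _; apply: (in_span_sizeX code).
    move=> s3 w hw i3 _ m3; split; rewrite /= ?i3 ?c5 //.
      by move=> y hy; mem_at m3; exact: glo.
    move=> j i; rewrite ltnS => hj hi.
    rewrite m3 -addnA leq_add2l ltn_add2l in_block //.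
    have [->|nj] := eqVneq j t.
      have -> : 9 * n + (t * g + i) - (9 * n + t * g) = i by lia.
      by rewrite hw // coef_ycoef.
    by rewrite ghi ?hhi //; lia.
    have := interp_cost_ge g0; rewrite /=; nia.
  - by move=> s1 [[d0 d1 d2 d3 d4] _ _ h]; split.
have := interp_cost_ge g0; rewrite /=; nia.
Qed.

(** The exponents of the basis met before step [u] of the inner loop in turn
    [t] of the outer one. *)
Definition emitted t u : seq (nat * nat) :=
  [seq ij <- [seq (i, j) | i <- iota 0 t, j <- iota 0 a] | a * ij.1 + b * ij.2 <= m] ++
  [seq ij <- [seq (t, j) | j <- iota 0 u] | a * ij.1 + b * ij.2 <= m].

Lemma emitted_end t : emitted t a = emitted t.+1 0.
Proof.
rewrite /emitted -!filter_cat; congr filter.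
by rewrite -[t.+1]addn1 iotaD allpairs_cat add0n /= !cats0.
Qed.

Lemma emitted_next t u : emitted t u.+1 =
  if a * t + b * u <= m then rcons (emitted t u) (t, u) else emitted t u.
Proof.
rewrite /emitted -[u.+1]addn1 iotaD map_cat filter_cat /= add0n.
by case: ifP => _; rewrite ?cats0 // catA cats1.
Qed.

Lemma run_Emit s : rows s -> run Emit s (100 * (g * (a + 1)) + 100)
  (fun s' => upto (size (basisB a b m)) (fun k => (message a b m f)`_k) (fmem s')).
Proof.
case=> e0 e1 e2 [e3 e4] hR.
have a0 := code_a_gt0 code; have nga := code_size code; have dg := code_deg code.
pose vals t u := [seq f`_ij.1`_ij.2 | ij <- emitted t u].
pose Inv t u s1 := [/\ [/\ imem s1 0 = a, imem s1 1 = b, imem s1 2 = m, imem s1 3 = n & imem s1 4 = g],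
      imem s1 5 = t, imem s1 8 = size (emitted t u) /\ size (emitted t u) <= t * a + u,
      forall k, k < size (emitted t u) -> fmem s1 k = (vals t u)`_k
      & forall j i, j < a -> i < g -> fmem s1 (9 * n + (j * g + i)) = f`_i`_j].
apply: run_le.
  apply: run_seq; apply: run_seti; [by rewrite /=|by rewrite /=|].
  apply: (run_for (n := (m %/ a).+1) (Inv := fun t => Inv t 0)).
  - by move=> t s1 _ [[d0 _ d2 _ _] d5 _ _ _] /=; rewrite d0 d2 d5 addn1.
  - by split.
  - move=> t s1 tm [[d0 d1 d2 d3 d4] d5 d8 hlo hhi].
    apply: (run_for (n := a) (Inv := fun u s2 => Inv t u s2 /\ imem s2 6 = u)).
    + by move=> u s2 _ [[[c0 _ _ _ _] _ _ _ _] c6] /=; rewrite c0 c6.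
    + by split.
    + move=> u s2 ua [[[c0 c1 c2 c3 c4] c5 [c8 cs] glo ghi] c6].
      have tg : t < g by lia.
      have hn : t * a + u < n by rewrite nga; apply: block_lt.
      rewrite /Inv /vals emitted_next.
      apply: run_if; rewrite /= c0 c1 c2 c5 c6 => hc.
        rewrite hc size_rcons.
        apply: run_seq; apply: run_setf;
          [by rewrite /= c8|by rewrite /= c3 c4 c5 c6 ghi|].
        apply: run_seti; [by rewrite /=|by rewrite /= c8 addn1|].
        split; last by rewrite /= c6.
        split=> //=.
        * by split=> //; lia.
        * move=> k; rewrite ltnS leq_eqVlt map_rcons nth_rcons size_map.
          by have [->|nk] /= := eqVneq k (size (emitted t u)); [rewrite ltnn|move=> hk; rewrite hk glo].
        * by move=> j i hj hi; dif; exact: ghi.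
      rewrite (negPf hc); apply: run_skip; split; last by rewrite /= c6.
      by split=> //=; split=> //; lia.
    + move=> s2 [[cc c5 [c8 cs] glo ghi] c6]; rewrite /Inv /vals -emitted_end.
      by split=> //=; [rewrite c5|split=> //; lia].
  - move=> s1 [_ _ _ h _] k hk.
    by have := h k; rewrite /vals /emitted /= cats0; apply.
have : (m %/ a).+1 * (a + 1) <= g * (a + 1) by rewrite leq_mul2r dg orbT.
have : (m %/ a).+1 <= g by [].
move: (m %/ a).+1 => T hT hTa; rewrite /=; nia.
Qed.

Lemma run_Unencode : yields Unencode [:: a; b; m; n] v
  (2000 * (g * interp_cost a + a * interp_cost g))
  (upto (size (basisB a b m)) (fun k => (message a b m f)`_k)).
Proof.
have a0 := code_a_gt0 code; have nga := code_size code.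
have g0 : 0 < g by apply: leq_ltn_trans (code_deg code).
apply: run_le.
  apply: run_seq; apply: run_post run_Group _ => s1 h1.
  apply: run_seq; apply: run_post (run_Columns h1) _ => s2 h2.
  apply: run_seq; apply: run_post (run_Rows h2) _ => s3 h3.
  exact: run_Emit.
have := interp_cost_ge a0; have := interp_cost_ge g0; rewrite nga.
move: (interp_cost a) (interp_cost g) => A G hG hA.
have : g * a <= g * A by rewrite leq_mul2l hA orbT.
have : g <= g * a by rewrite leq_pmulr.
nia.
Qed.

End Unencode.

(** * From operation counts to the stated bounds *)

Section Bounds.
Local Open Scope ring_scope.
Variables (R : realType) (M : nat -> R) (mul : cmd).
Hypotheses (hmul : multiplies mul M) (hM : multiplication_time M).

(** A positive cost is what makes M grow at least linearly. *)
Lemma exec_cost_gt0 (F : fieldType) c (s : store F) k s' : exec c s k s' -> (0 < k)%N.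
Proof. by case. Qed.

Lemma M_div m n : (0 < m)%N -> (m <= n)%N -> M m / m%:R <= M n / n%:R.
Proof. by case: hM => _ h _; apply: h. Qed.

(** Every run costs at least 1, and M(n) / n is nondecreasing. *)
Lemma M_ge n : (0 < n)%N -> n%:R <= M n.
Proof.
move=> n0.
(* any finite field and any two polynomials will do *)
have [k kM [s' /exec_cost_gt0 k0 _]] := hmul (p := 0 : {poly 'F_2}) (q := 0) (ltnSn 0)
  ltac:(by rewrite size_poly0) ltac:(by rewrite size_poly0).
have h1 : 1 <= M 1 by apply: le_trans kM; rewrite ler1n.
have := M_div (ltnSn 0) n0; rewrite divr1 => /(le_trans h1).
by rewrite ler_pdivlMr ?mul1r // ltr0n.
Qed.

Lemma M_ge0 n : (0 < n)%N -> 0 <= M n.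
Proof. by move=> n0; apply: le_trans (M_ge n0). Qed.

(** The products of a level are no more expensive than one product of the
    total size. *)
Lemma M_mul k n : (0 < k)%N -> (0 < n)%N -> k%:R * M n <= M (k * n)%N.
Proof.
move=> k0 n0; have := M_div n0 (leq_pmull n k0).
rewrite ler_pdivrMr ?ltr0n // natrM invfM => h.
apply: le_trans (ler_wpM2l (ler0n R k) h) _.
by rewrite le_eqVlt; apply/orP; left; apply/eqP; field; rewrite !pnatr_eq0 -!lt0n k0 n0.
Qed.

Lemma M_mono m n : (0 < m)%N -> (m <= n)%N -> M m <= M n.
Proof.
move=> m0 mn; have n0 := leq_trans m0 mn.
have := M_div m0 mn; rewrite ler_pdivrMr ?ltr0n // => /le_trans; apply.
by rewrite mulrAC ler_pdivrMr ?ltr0n // ler_wpM2l ?M_ge0 // ler_nat.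
Qed.

(** Operation counts are integers, so M can be replaced by its integer part,
    and k mu(n) <= mu(k n) remains true. *)
Definition mu (n : nat) : nat := Num.truncn (M n).

Lemma mu_le n : (0 < n)%N -> (mu n)%:R <= M n.
Proof. by move=> n0; rewrite truncn_le M_ge0. Qed.

Lemma mu_ge n : (0 < n)%N -> (n <= mu n)%N.
Proof. by move=> n0; rewrite truncn_ge_nat ?M_ge0 ?M_ge. Qed.

Lemma mu_mul k n : (0 < k)%N -> (0 < n)%N -> (k * mu n <= mu (k * n))%N.
Proof.
move=> k0 n0; rewrite truncn_ge_nat ?M_ge0 ?muln_gt0 ?k0 // natrM.
by apply: le_trans (M_mul k0 n0); rewrite ler_wpM2l // mu_le.
Qed.

Lemma mul_product_program (F : finFieldType) : product_program F mul mu.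
Proof.
move=> n p q n0 sp sq; have [k kM [s' x e]] := hmul n0 sp sq.
exists k, s'; split=> //; first by rewrite truncn_ge_nat ?M_ge0.
move=> i hi; have := congr1 (fun w => w`_i) e.
by rewrite nth_block size_mkseq hi nth_mkseq.
Qed.

Lemma lg_ge1 (t : R) : 1 <= lg t.
Proof. by rewrite /lg le_max lexx. Qed.

Lemma lg_mono (s t : R) : 0 < s -> s <= t -> lg s <= lg t.
Proof.
move=> s0 st; rewrite /lg ge_max le_max lexx /= le_max.
by rewrite ler_ln ?posrE ?st ?orbT // (lt_le_trans s0).
Qed.

(** Used for lg (lg n) <= lg n. *)
Lemma lg_le (t : R) : 1 <= t -> lg t <= t.
Proof.
move=> t1; rewrite /lg ge_max t1 /=; have := @le_ln1Dx R (t - 1).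
rewrite addrCA subrr addr0 => h; apply: le_trans (h _) _; lra.
Qed.

(** The power of two N is less than 2 n, so that M(N) is within a constant
    factor of M(n). *)
Lemma interp_cost_le : exists C : R, 0 <= C /\
  forall n, (0 < n)%N -> (interp_cost mu n)%:R <= C * (M n * lg n%:R).
Proof.
have [_ _ /(_ 2 isT) [K2 hK]] := hM.
have ln2 : 0 < ln 2 :> R by apply: ln_gt0; rewrite ltr1n.
pose C1 := 2 + (ln 2)^-1 : R.
have C10 : 0 <= C1 by rewrite addr_ge0 // invr_ge0 ltW.
have K20 : 0 <= K2.
  have := hK 1%N isT => h.
  have M1 : 0 < M 1 by apply: lt_le_trans (M_ge (ltnSn 0)); rewrite ltr0n.
  by rewrite -(pmulr_lge0 _ M1); apply: le_trans h; apply: M_ge0.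
exists (20 * 1000 * (C1 * K2)); split; first by rewrite !mulr_ge0.
move=> n n0; set U := up_log 2 n.
have U2 : (2 ^ U <= 2 * n)%N.
  have [n1|n1] := leqP n 1; first by rewrite /U (_ : n = 1%N) ?up_log1 //; lia.
  have /andP[] := up_log_bounds (isT : (1 < 2)%N) n1; rewrite -/U.
  by case: (U) => [|u] /=; rewrite ?expnS; lia.
have U0 : (0 < 2 ^ U)%N by rewrite expn_gt0.
have h1 : (mu (2 ^ U))%:R <= K2 * M n.
  apply: le_trans (mu_le U0) _; apply: le_trans (hK n n0).
  exact: M_mono.
have h2 : U.+1%:R <= C1 * lg n%:R.
  have : (2 ^ U)%:R <= (2 * n)%:R :> R by rewrite ler_nat.
  rewrite -ler_ln ?posrE ?ltr0n ?muln_gt0 // natrX lnXn ?ltr0n // natrM lnM ?posrE ?ltr0n //.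
  move=> h.
  have hU : U%:R <= 1 + ln n%:R / ln 2 :> R.
    have e2 : 1 + ln n%:R / ln 2 = (ln 2 + ln n%:R) / ln 2 :> R.
      by rewrite mulrDl divff ?gt_eqF.
    by rewrite e2 ler_pdivlMr // mulr_natl.
  have l1 := lg_ge1 n%:R.
  have l2 : ln n%:R / ln 2 <= lg n%:R / ln 2 :> R.
    by apply: ler_wpM2r; [rewrite invr_ge0 ltW | rewrite /lg le_max lexx orbT].
  rewrite -natr1 /C1 mulrDl [_^-1 * _]mulrC; lra.
rewrite /interp_cost -/U !natrM.
rewrite [leRHS](_ : _ = 20 * (1000 * (C1 * lg n%:R) * (K2 * M n))); last by ring.
by rewrite ler_wpM2l // ler_pM // ?mulr_ge0 // ler_wpM2l.
Qed.

Lemma unencoding_bound_soft : exists K : R, forall gx ay : nat, (0 < gx)%N -> (0 < ay)%N ->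
  unencoding_bound M gx ay <= K * ((gx * ay)%:R * lg (gx * ay)%:R ^+ 3).
Proof.
have [[K0 hK] _ _] := hM.
(* M contributes lg q and lg (lg q), the bound another lg q *)
have half (p q : nat) : (0 < p)%N -> (0 < q)%N ->
    p%:R * M q * lg q%:R <= `|K0| * ((p * q)%:R * lg (p * q)%:R ^+ 3).
  move=> p0 q0; set l := lg (p * q)%:R.
  have q1 : 0 < q%:R :> R by rewrite ltr0n.
  have lq : lg q%:R <= l by apply: lg_mono => //; rewrite ler_nat leq_pmull.
  have l1 : 1 <= lg q%:R :> R := lg_ge1 _.
  have l0 : 0 <= lg q%:R :> R by apply: le_trans l1.
  have l2 : lg (lg q%:R) <= l by apply: le_trans (lg_le l1) lq.
  have l3 : 0 <= lg (lg q%:R) :> R by apply: le_trans (lg_ge1 _).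
  have h : M q <= `|K0| * (q%:R * l * l).
    apply: le_trans (hK q q0) _; apply: le_trans (ler_wpM2r _ (ler_norm K0)) _.
      by rewrite !mulr_ge0.
    by rewrite ler_wpM2l // ler_pM ?mulr_ge0 // ler_wpM2l.
  rewrite [leRHS](_ : _ = p%:R * (`|K0| * (q%:R * l * l)) * l); last first.
    by rewrite natrM; ring.
  by rewrite ler_pM ?mulr_ge0 ?M_ge0 // ler_wpM2l.
exists (2 * `|K0|) => gx ay g0 a0; rewrite /unencoding_bound.
have h1 := half ay gx a0 g0; have h2 := half gx ay g0 a0.
rewrite mulnC in h1; lra.
Qed.

End Bounds.

Local Open Scope ring_scope.

Theorem propositionV5 (R : realType) (M : nat -> R) (mul : cmd)
    (hmul : multiplies mul M) (hM : multiplication_time M) :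
  exists (unencode : cmd) (A K : R) (e : nat),
  forall (F : finFieldType) (a b : nat) (H : {poly {poly F}})
    (P : seq (F * F)) (m : nat) (c : seq F),
    maximal_semi_grid_code a b H P m -> in_code a b H P m c ->
  exists (f : {poly {poly F}}) (k : nat),
    [/\ [/\ RR_space a b H m f, standard_form a f & ev P f = c],
        forall g : {poly {poly F}},
          RR_space a b H m g -> standard_form a g -> ev P g = c -> g = f,
        computes unencode [:: a; b; m; size P] (input_data a b H P c)
          k (message a b m f),
        k%:R <= A * unencoding_bound M (nX P) (nuY P)
      & unencoding_bound M (nX P) (nuY P)
          <= K * ((size P)%:R * lg (size P)%:R ^+ e)].
Proof.
have [C [C0 hC]] := interp_cost_le hmul hM.
have [K hK] := unencoding_bound_soft hmul hM.
exists (Unencode mul), (2000 * C), K, 3 => F a b H P m c code [f0 [f hf f0f] ->].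
have a0 := code_a_gt0 code; have nga := code_size code.
have g0 : (0 < nX P)%N by apply: leq_ltn_trans (code_deg code).
have nu : nuY P = a by case: code.
have Ef := ev_eq_mod code f0f; rewrite Ef.
have [k [s' [x kK hs]]] := run_Unencode (@mul_product_program R M mul hmul hM F)
  (mu_ge hmul hM) (mu_mul hmul hM) code hf.
exists f, k; split.
- split=> //; last exact: (in_span_standard hf).
  by exists f; [exact: hf | exists 0; rewrite subrr mul0r].
- move=> g [g' hg' gg'] sg eg.
  have -> : g = g' by apply: (standard_unique code) gg' => //; apply: in_span_standard hg'.
  by apply: (in_span_inj code hg' hf); rewrite -eg (ev_eq_mod code gg').
- exists s' => //; rewrite size_map.
  apply: (eq_from_nth (x0 := 0)); rewrite !size_map ?size_iota // => i hi.
  by rewrite nth_block hi hs.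
- rewrite nu; apply: le_trans (_ : (2000 * (nX P * interp_cost (mu M) a
      + a * interp_cost (mu M) (nX P)))%:R <= _); first by rewrite ler_nat.
  have h1 := ler_wpM2l (ler0n R (nX P)) (hC a a0).
  have h2 := ler_wpM2l (ler0n R a) (hC _ g0).
  move: (interp_cost _ a) (interp_cost _ (nX P)) h1 h2 => ca cg h1 h2.
  by rewrite natrM natrD !natrM /unencoding_bound; lra.
- by rewrite nu nga; apply: hK.
Qed.
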